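(* Let $\mathcal{A}$ be a multitensor category over $k$ and let $\mathcal{C}$ be a two-sided Serre tensor-ideal of $\mathcal{A}$. Then $\mathcal{A}/\mathcal{C}$, with the monoidal structure induced from $\mathcal{A}$ (as defined in the context), is a multitensor category over $k$.
   Context: $k$ is an algebraically closed field. A $k$-linear abelian category is locally finite if all its Hom spaces are finite dimensional over $k$ and every object has finite length. A multitensor category over $k$ is a locally finite $k$-linear abelian rigid monoidal category with bilinear tensor product; its tensor product is automatically biexact. A Serre subcategory of an abelian category $\mathcal{A}$ is a full additive subcategory closed under subobjects, quotients and extensions. The quotient category $\mathcal{A}/\mathcal{C}$ has the same objects as $\mathcal{A}$, and $\mathrm{Hom}_{\mathcal{A}/\mathcal{C}}(M,N)=\varinjlim_{M',N'}\mathrm{Hom}_{\mathcal{A}}(M',N/N')$, where $M'\subset M$ and $N'\subset N$ run over the subobjects with $M/M'\in\mathcal{C}$ and $N'\in\mathcal{C}$; $T:\mathcal{A}\to\mathcal{A}/\mathcal{C}$ is the canonical functor. For $f:M'\to N/N'$ in this direct system, the morphism $M\to N$ of $\mathcal{A}/\mathcal{C}$ represented by $f$ is also written $Tf$; every morphism of $\mathcal{A}/\mathcal{C}$ is of this form. A two-sided Serre tensor-ideal of an abelian monoidal category $\mathcal{A}$ is a Serre subcategory $\mathcal{C}$ such that $X\otimes Y\in\mathcal{C}$ and $Y\otimes X\in\mathcal{C}$ for all $X\in\mathcal{A}$, $Y\in\mathcal{C}$. Monoidal structure on $\mathcal{A}/\mathcal{C}$ (for $\mathcal{A}$ with biexact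 tensor product): the tensor product of objects is that of $\mathcal{A}$, and the unit object is that of $\mathcal{A}$. If $\bar f=Tf:M\to N$ and $\bar g=Tg:X\to Y$ are morphisms of $\mathcal{A}/\mathcal{C}$, represented by $f:M'\to N/N'$ and $g:X'\to Y/Y'$, then $\bar f\otimes\bar g:=T(f\otimes g):M\otimes X\to N\otimes Y$ is the morphism of $\mathcal{A}/\mathcal{C}$ represented by $f\otimes g:M'\otimes X'\to (N/N')\otimes(Y/Y')$, where $M'\otimes X'$ is regarded as a subobject of $M\otimes X$ and $(N/N')\otimes(Y/Y')$ as a quotient of $N\otimes Y$; this is well defined. The associativity constraint is $\bar a_{X,Y,Z}=T(a_{X,Y,Z})$ and the left and right unit isomorphisms are $T(l_X)$, $T(r_X)$, where $a,l,r$ are those of $\mathcal{A}$. *)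

(* Defs.v *)
From HB Require Import structures.
From mathcomp Require Import all_boot all_order all_algebra.
From mathcomp Require Import boolp.

Set Implicit Arguments.
Unset Strict Implicit.
Unset Printing Implicit Defensive.

Import GRing.Theory.
Local Open Scope ring_scope.
Local Open Scope quotient_scope.

Declare Scope cat_scope.
Delimit Scope cat_scope with cat.
Local Open Scope cat_scope.

(* Objects, Hom spaces and composition; the axioms of a k-linear category are
   the predicate [linear_category]. *)
Record catData (k : fieldType) := CatData {
  Ob :> Type;
  Mor : Ob -> Ob -> lmodType k;
  idm : forall X, Mor X X;
  cmp : forall X Y Z, Mor Y Z -> Mor X Y -> Mor X Z }.
Arguments Mor {k c} X Y.
Arguments idm {k c} X.
Arguments cmp {k c X Y Z} g f.

Notation "g ∘ f" := (cmp g f) (at level 40, left associativity) : cat_scope.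
Notation "\1_ X" := (idm X) (at level 8, format "\1_ X") : cat_scope.

Section Categories.
Variables (k : fieldType) (A : catData k).
Implicit Types X Y Z W : A.

Record linear_category : Prop := LinearCategory {
  lc_assoc : forall X Y Z W (h : Mor Z W) (g : Mor Y Z) (f : Mor X Y),
    h ∘ (g ∘ f) = h ∘ g ∘ f;
  lc_idl : forall X Y (f : Mor X Y), \1_Y ∘ f = f;
  lc_idr : forall X Y (f : Mor X Y), f ∘ \1_X = f;
  lc_linl : forall X Y Z (f : Mor X Y) (c : k) (g g' : Mor Y Z),
    (c *: g + g') ∘ f = c *: (g ∘ f) + g' ∘ f;
  lc_linr : forall X Y Z (g : Mor Y Z) (c : k) (f f' : Mor X Y),
    g ∘ (c *: f + f') = c *: (g ∘ f) + g ∘ f' }.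

Definition is_inverse X Y (f : Mor X Y) (g : Mor Y X) : Prop :=
  g ∘ f = \1_X /\ f ∘ g = \1_Y.

Definition is_iso X Y (f : Mor X Y) : Prop := exists g, is_inverse f g.

Definition mono X Y (f : Mor X Y) : Prop :=
  forall W (g h : Mor W X), f ∘ g = f ∘ h -> g = h.

Definition epi X Y (f : Mor X Y) : Prop :=
  forall W (g h : Mor Y W), g ∘ f = h ∘ f -> g = h.

Definition zero_ob Z : Prop :=
  (forall X (f : Mor X Z), f = 0) /\ (forall X (f : Mor Z X), f = 0).

Definition is_biproduct X Y P (i1 : Mor X P) (i2 : Mor Y P)
    (p1 : Mor P X) (p2 : Mor P Y) : Prop :=
  [/\ p1 ∘ i1 = \1_X, p2 ∘ i2 = \1_Y, p1 ∘ i2 = 0, p2 ∘ i1 = 0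
    & i1 ∘ p1 + i2 ∘ p2 = \1_P].

Definition is_kernel X Y K (f : Mor X Y) (i : Mor K X) : Prop :=
  f ∘ i = 0 /\ forall W (g : Mor W X), f ∘ g = 0 -> exists! h, i ∘ h = g.

Definition is_cokernel X Y Q (f : Mor X Y) (p : Mor Y Q) : Prop :=
  p ∘ f = 0 /\ forall W (g : Mor Y W), g ∘ f = 0 -> exists! h, h ∘ p = g.

Definition short_exact X Y Z (i : Mor X Y) (p : Mor Y Z) : Prop :=
  is_kernel p i /\ is_cokernel i p.

Record abelian : Prop := Abelian {
  ab_linear : linear_category;
  ab_zero : exists Z, zero_ob Z;
  ab_biproduct : forall X Y, exists P (i1 : Mor X P) (i2 : Mor Y P)
    (p1 : Mor P X) (p2 : Mor P Y), is_biproduct i1 i2 p1 p2;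
  ab_kernel : forall X Y (f : Mor X Y), exists K (i : Mor K X), is_kernel f i;
  ab_cokernel : forall X Y (f : Mor X Y),
    exists Q (p : Mor Y Q), is_cokernel f p;
  ab_mono : forall X Y (i : Mor X Y), mono i ->
    exists Z (f : Mor Y Z), is_kernel f i;
  ab_epi : forall X Y (p : Mor X Y), epi p ->
    exists W (f : Mor W X), is_cokernel f p }.

Definition simple_ob X : Prop :=
  ~ zero_ob X /\
  forall Y (i : Mor Y X), mono i -> zero_ob Y \/ is_iso i.

(* Existence of a filtration 0 = X_0 ⊂ ... ⊂ X_n = X with simple quotients. *)
Inductive finite_length : A -> Prop :=
| finite_length0 X : zero_ob X -> finite_length X
| finite_lengthS X Y Z (i : Mor X Y) (p : Mor Y Z) :
    finite_length X -> short_exact i p -> simple_ob Z -> finite_length Y.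

Definition finite_dim (V : lmodType k) : Prop :=
  exists n, inhabited (Vector.axiom n V).

Definition locally_finite : Prop :=
  (forall X Y, finite_dim (Mor X Y)) /\ (forall X, finite_length X).

(* Full subcategories are given by predicates on objects. *)
Record serre (C : A -> Prop) : Prop := Serre {
  serre_zero : forall Z, zero_ob Z -> C Z;
  serre_biproduct : forall X Y P (i1 : Mor X P) (i2 : Mor Y P)
    (p1 : Mor P X) (p2 : Mor P Y),
    is_biproduct i1 i2 p1 p2 -> C X -> C Y -> C P;
  serre_sub : forall X Y (i : Mor X Y), mono i -> C Y -> C X;
  serre_quo : forall X Y (p : Mor X Y), epi p -> C X -> C Y;
  serre_ext : forall X Y Z (i : Mor X Y) (p : Mor Y Z),
    short_exact i p -> C X -> C Z -> C Y }.

(* i is (the inclusion of) a subobject M' of M with M/M' in C *)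
Definition sub_mod (C : A -> Prop) M' M (i : Mor M' M) : Prop :=
  exists Q (p : Mor M Q), short_exact i p /\ C Q.

(* p is the projection onto a quotient N/N' of N with N' in C *)
Definition quo_mod (C : A -> Prop) N Q (p : Mor N Q) : Prop :=
  exists N' (i : Mor N' N), short_exact i p /\ C N'.

End Categories.

Record monData (k : fieldType) := MonData {
  mcat :> catData k;
  tens : mcat -> mcat -> mcat;
  tensm : forall X X' Y Y', Mor X X' -> Mor Y Y' -> Mor (tens X Y) (tens X' Y');
  unitob : mcat;
  assocm : forall X Y Z, Mor (tens (tens X Y) Z) (tens X (tens Y Z));
  lunitm : forall X, Mor (tens unitob X) X;
  runitm : forall X, Mor (tens X unitob) X }.
Arguments tens {k m} X Y.
Arguments tensm {k m X X' Y Y'} f g.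
Arguments unitob {k m}.
Arguments assocm {k m} X Y Z.
Arguments lunitm {k m} X.
Arguments runitm {k m} X.

Notation "X ⊗ Y" := (tens X Y) (at level 40, left associativity) : cat_scope.
Notation "f ⊠ g" := (tensm f g) (at level 35, right associativity) : cat_scope.
Notation "𝟙" := unitob : cat_scope.

Section Monoidal.
Variables (k : fieldType) (A : monData k).
Implicit Types X Y Z W D : A.

Record monoidal : Prop := Monoidal {
  mo_id : forall X Y, \1_X ⊠ \1_Y = \1_(X ⊗ Y);
  mo_cmp : forall X X' X'' Y Y' Y'' (f' : Mor X' X'') (f : Mor X X')
    (g' : Mor Y' Y'') (g : Mor Y Y'), (f' ∘ f) ⊠ (g' ∘ g) = f' ⊠ g' ∘ f ⊠ g;
  mo_assoc_nat : forall X X' Y Y' Z Z' (f : Mor X X') (g : Mor Y Y')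
    (h : Mor Z Z'),
    assocm X' Y' Z' ∘ (f ⊠ g) ⊠ h = f ⊠ (g ⊠ h) ∘ assocm X Y Z;
  mo_lunit_nat : forall X Y (f : Mor X Y), lunitm Y ∘ \1_𝟙 ⊠ f = f ∘ lunitm X;
  mo_runit_nat : forall X Y (f : Mor X Y), runitm Y ∘ f ⊠ \1_𝟙 = f ∘ runitm X;
  mo_assoc_iso : forall X Y Z, is_iso (assocm X Y Z);
  mo_lunit_iso : forall X, is_iso (lunitm X);
  mo_runit_iso : forall X, is_iso (runitm X);
  mo_pentagon : forall W X Y Z,
    assocm W X (Y ⊗ Z) ∘ assocm (W ⊗ X) Y Z
    = \1_W ⊠ assocm X Y Z ∘ assocm W (X ⊗ Y) Z ∘ assocm W X Y ⊠ \1_Z;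
  mo_triangle : forall X Y,
    \1_X ⊠ lunitm Y ∘ assocm X 𝟙 Y = runitm X ⊠ \1_Y }.

Definition tens_bilinear : Prop :=
  (forall X X' Y Y' (c : k) (f f' : Mor X X') (g : Mor Y Y'),
     (c *: f + f') ⊠ g = c *: (f ⊠ g) + f' ⊠ g) /\
  (forall X X' Y Y' (c : k) (f : Mor X X') (g g' : Mor Y Y'),
     f ⊠ (c *: g + g') = c *: (f ⊠ g) + f ⊠ g').

(* D is a left dual of X and X is a right dual of D. The two identities are
   the zigzag identities, composed with the unit isomorphisms. *)
Definition dual_pair D X (ev : Mor (D ⊗ X) 𝟙) (coev : Mor 𝟙 (X ⊗ D)) : Prop :=
  runitm X ∘ \1_X ⊠ ev ∘ assocm X D X ∘ coev ⊠ \1_X = lunitm X /\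
  exists2 b, is_inverse (assocm D X D) b &
    lunitm D ∘ ev ⊠ \1_D ∘ b ∘ \1_D ⊠ coev = runitm D.

Definition rigid : Prop := forall X,
  (exists D ev coev, @dual_pair D X ev coev) /\
  (exists D ev coev, @dual_pair X D ev coev).

Record multitensor : Prop := Multitensor {
  mt_abelian : abelian A;
  mt_locally_finite : locally_finite A;
  mt_monoidal : monoidal;
  mt_bilinear : tens_bilinear;
  mt_rigid : rigid }.

Definition serre_tensor_ideal (C : A -> Prop) : Prop :=
  serre C /\ forall X Y, C Y -> C (X ⊗ Y) /\ C (Y ⊗ X).

End Monoidal.

Section Opposite.
Variables (k : fieldType) (A : catData k).

Definition opcat : catData k :=
  @CatData k A (fun X Y => Mor Y X) (fun X => \1_X) (fun X Y Z g f => f ∘ g).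

Lemma linear_op : linear_category A -> linear_category opcat.
Proof.
case=> h1 h2 h3 h4 h5; split=> /=.
- by move=> X Y Z W h g f; rewrite /= h1.
- by move=> X Y f; apply: h3.
- by move=> X Y f; apply: h2.
- by move=> X Y Z f c g g'; apply: h5.
- by move=> X Y Z f c g g'; apply: h4.
Qed.

Lemma abelian_op : abelian A -> abelian opcat.
Proof.
case=> hl [Z [hz1 hz2]] hb hk hc hm he; split.
- exact: linear_op.
- by exists Z; split.
- move=> X Y; have [P [i1 [i2 [p1 [p2 [h1 h2 h3 h4 h5]]]]]] := hb X Y.
  by exists P, p1, p2, i1, i2; split.
- by move=> X Y f; apply: (hc Y X f).
- by move=> X Y f; apply: (hk Y X f).
- by move=> X Y i hi; apply: (he Y X i).
- by move=> X Y i hi; apply: (hm Y X i).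
Qed.

Lemma serre_op (C : A -> Prop) : serre C -> @serre k opcat C.
Proof.
case=> h1 h2 h3 h4 h5; split.
- by move=> Z [? ?]; apply: h1; split.
- move=> X Y P i1 i2 p1 p2 [? ? ? ? ?]; apply: (h2 X Y P p1 p2 i1 i2).
  by split.
- by move=> X Y i hi; apply: (h4 Y X i).
- by move=> X Y i hi; apply: (h3 Y X i).
- by move=> X Y Z i p [hk hc] CX CZ; apply: (h5 Z Y X p i).
Qed.

End Opposite.

Section Linear.
Variables (k : fieldType) (A : catData k) (hA : linear_category A).
Implicit Types X Y Z W : A.

Lemma cmp0 X Y Z (g : Mor Y Z) : g ∘ (0 : Mor X Y) = 0.
Proof. by rewrite -[0](addNr 0) -scaleN1r (lc_linr hA) scaleN1r addNr. Qed.

Lemma cmp0l X Y Z (f : Mor X Y) : (0 : Mor Y Z) ∘ f = 0.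
Proof. by rewrite -[0](addNr 0) -scaleN1r (lc_linl hA) scaleN1r addNr. Qed.

Lemma cmpDr X Y Z (g : Mor Y Z) (f f' : Mor X Y) :
  g ∘ (f + f') = g ∘ f + g ∘ f'.
Proof. by rewrite -[f]scale1r (lc_linr hA) !scale1r. Qed.

Lemma cmpDl X Y Z (f : Mor X Y) (g g' : Mor Y Z) :
  (g + g') ∘ f = g ∘ f + g' ∘ f.
Proof. by rewrite -[g]scale1r (lc_linl hA) !scale1r. Qed.

Lemma cmpZr X Y Z (g : Mor Y Z) c (f : Mor X Y) :
  g ∘ (c *: f) = c *: (g ∘ f).
Proof. by rewrite -[c *: f]addr0 (lc_linr hA) cmp0 addr0. Qed.

Lemma cmpZl X Y Z (f : Mor X Y) c (g : Mor Y Z) :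
  (c *: g) ∘ f = c *: (g ∘ f).
Proof. by rewrite -[c *: g]addr0 (lc_linl hA) cmp0l addr0. Qed.

Lemma cmpBr X Y Z (g : Mor Y Z) (f f' : Mor X Y) :
  g ∘ (f - f') = g ∘ f - g ∘ f'.
Proof. by rewrite cmpDr -[- f']scaleN1r cmpZr scaleN1r. Qed.

Lemma cmpBl X Y Z (f : Mor X Y) (g g' : Mor Y Z) :
  (g - g') ∘ f = g ∘ f - g' ∘ f.
Proof. by rewrite cmpDl -[- g']scaleN1r cmpZl scaleN1r. Qed.

Lemma monoP0 X Y (f : Mor X Y) :
  (forall W (g : Mor W X), f ∘ g = 0 -> g = 0) -> mono f.
Proof.
move=> h W g g' e; apply/eqP; rewrite -subr_eq0; apply/eqP/h.
by rewrite cmpBr e subrr.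
Qed.

Lemma mono_cmp X Y Z (g : Mor Y Z) (f : Mor X Y) :
  mono g -> mono f -> mono (g ∘ f).
Proof. by move=> hg hf W a b; rewrite -!(lc_assoc hA) => /hg /hf. Qed.

Lemma mono_cmpr X Y Z (g : Mor Y Z) (f : Mor X Y) : mono (g ∘ f) -> mono f.
Proof.
by move=> h W a b e; apply: h; rewrite -!(lc_assoc hA) e.
Qed.

Lemma kernel_mono X Y K (f : Mor X Y) (i : Mor K X) : is_kernel f i -> mono i.
Proof.
case=> fi0 u W g h e.
have [|x [_ xu]] := u _ (i ∘ g); first by rewrite (lc_assoc hA) fi0 cmp0l.
by rewrite -(xu g) // -(xu h).
Qed.

Lemma kernel_fact X Y K (f : Mor X Y) (i : Mor K X) W (g : Mor W X) :
  is_kernel f i -> f ∘ g = 0 -> exists h, i ∘ h = g.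
Proof. by case=> _ u /u [h [? _]]; exists h. Qed.

Lemma is_kernelI X Y K (f : Mor X Y) (i : Mor K X) :
  mono i -> f ∘ i = 0 ->
  (forall W (g : Mor W X), f ∘ g = 0 -> exists h, i ∘ h = g) -> is_kernel f i.
Proof.
move=> mi fi0 u; split=> // W g /u [h hg]; exists h; split=> // h' e.
by apply: mi; rewrite hg.
Qed.

Lemma mono_id X : mono \1_X.
Proof. by move=> W g h; rewrite !(lc_idl hA). Qed.

End Linear.

Section LinearDual.
Variables (k : fieldType) (A : catData k) (hA : linear_category A).
Implicit Types X Y Z W : A.
Let hO := linear_op hA.

Lemma epiP0 X Y (f : Mor X Y) :
  (forall W (g : Mor Y W), g ∘ f = 0 -> g = 0) -> epi f.
Proof. exact: (@monoP0 k (opcat A) hO Y X f). Qed.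

Lemma epi_cmp X Y Z (g : Mor Y Z) (f : Mor X Y) :
  epi g -> epi f -> epi (g ∘ f).
Proof. by move=> hg hf; apply: (@mono_cmp k (opcat A) hO Z Y X f g). Qed.

Lemma epi_cmpl X Y Z (g : Mor Y Z) (f : Mor X Y) : epi (g ∘ f) -> epi g.
Proof. exact: (@mono_cmpr k (opcat A) hO Z Y X f g). Qed.

Lemma cokernel_epi X Y Q (f : Mor X Y) (p : Mor Y Q) : is_cokernel f p -> epi p.
Proof. exact: (@kernel_mono k (opcat A) hO Y X Q f p). Qed.

Lemma cokernel_fact X Y Q (f : Mor X Y) (p : Mor Y Q) W (g : Mor Y W) :
  is_cokernel f p -> g ∘ f = 0 -> exists h, h ∘ p = g.
Proof. exact: (@kernel_fact k (opcat A) Y X Q f p W g). Qed.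

Lemma is_cokernelI X Y Q (f : Mor X Y) (p : Mor Y Q) :
  epi p -> p ∘ f = 0 ->
  (forall W (g : Mor Y W), g ∘ f = 0 -> exists h, h ∘ p = g) ->
  is_cokernel f p.
Proof. exact: (@is_kernelI k (opcat A) Y X Q f p). Qed.

Lemma epi_id X : epi \1_X.
Proof. exact: (@mono_id k (opcat A) hO X). Qed.

End LinearDual.

Section Abelian.
Variables (k : fieldType) (A : catData k) (hA : abelian A).
Implicit Types X Y Z W : A.
Let hL := ab_linear hA.
Let assoc := lc_assoc hL.

Lemma mono_short_exact X Y (i : Mor X Y) :
  mono i -> exists Q (p : Mor Y Q), short_exact i p.
Proof.
move=> mi; have [Q [p hp]] := ab_cokernel hA i; exists Q, p; split=> //.
have [Z [f hf]] := ab_mono hA mi.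
apply: (is_kernelI mi) => [|W g pg0]; first by case: hp.
apply: (kernel_fact hf); have [h <-] := cokernel_fact hp (proj1 hf).
by rewrite -assoc pg0 (cmp0 hL).
Qed.

End Abelian.

Section AbelianDual.
Variables (k : fieldType) (A : catData k) (hA : abelian A).
Implicit Types X Y Z W : A.
Let hL := ab_linear hA.
Let assoc := lc_assoc hL.

Lemma epi_short_exact X Y (p : Mor X Y) :
  epi p -> exists K (i : Mor K X), short_exact i p.
Proof.
move=> ep; have [K [i [h1 h2]]] := @mono_short_exact k _ (abelian_op hA) Y X p ep.
by exists K, i.
Qed.

Lemma image_fact X Y (f : Mor X Y) :
  exists I (e : Mor X I) (m : Mor I Y), [/\ epi e, mono m & m ∘ e = f].
Proof.
have [Q [c hc]] := ab_cokernel hA f.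
have [I [m hm]] := ab_kernel hA c.
have [e me] := kernel_fact hm (proj1 hc).
have mm := kernel_mono hL hm.
exists I, e, m; split=> //; apply: (epiP0 hL) => W g ge0.
have [K [j hj]] := ab_kernel hA g.
have mj := kernel_mono hL hj.
have [e' je'] := kernel_fact hj ge0.
have [R [q [kq cq]]] := mono_short_exact hA (mono_cmp hL mm mj).
have qf : q ∘ f = 0.
  by rewrite -me -je' (assoc m j e') assoc (proj1 kq) (cmp0l hL).
have [t tc] := cokernel_fact hc qf.
have qm : q ∘ m = 0 by rewrite -tc -assoc (proj1 hm) (cmp0 hL).
have [s hs] := kernel_fact kq qm.
have js : j ∘ s = \1_I.
  by apply: mm; rewrite (lc_idr hL) assoc.
by rewrite -[g](lc_idr hL) -js assoc (proj1 hj) (cmp0l hL).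
Qed.

Lemma epi_pullback X Y Z (e : Mor X Z) (f : Mor Y Z) : epi e ->
  exists W (w : Mor W Y) (n : Mor W X), epi w /\ e ∘ n = f ∘ w.
Proof.
move=> ee.
have [P [i1 [i2 [p1 [p2 [h11 h22 h12 h21 h]]]]]] := ab_biproduct hA X Y.
pose phi := e ∘ p1 - f ∘ p2.
have phi1 : phi ∘ i1 = e.
  by rewrite /phi (cmpBl hL) -!assoc h11 h21 (lc_idr hL) (cmp0 hL) subr0.
have ephi : epi phi by apply: (@epi_cmpl _ _ hL _ _ _ phi i1); rewrite phi1.
have [W [j [kj cj]]] := epi_short_exact ephi.
exists W, (p2 ∘ j), (p1 ∘ j); split.
  apply: (epiP0 hL) => T s s0.
  have [c hc] : exists c, c ∘ phi = s ∘ p2.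
    by apply: (cokernel_fact cj); rewrite -assoc.
  have c0 : c = 0.
    apply: ee; rewrite (cmp0l hL) -phi1 assoc hc -assoc h21; exact: cmp0.
  rewrite -[s](lc_idr hL) -h22 assoc -hc c0 !(cmp0l hL) //.
apply/eqP; rewrite -subr_eq0 !assoc -(cmpBl hL) -/phi.
by rewrite (proj1 kj).
Qed.

End AbelianDual.

Section SerreSub.
Variables (k : fieldType) (A : catData k) (hA : abelian A).
Variables (C : A -> Prop) (hC : serre C).
Implicit Types X Y Z W : A.
Let hL := ab_linear hA.
Let assoc := lc_assoc hL.

Lemma sub_mod_mono X Y (i : Mor X Y) : sub_mod C i -> mono i.
Proof. by case=> Q [p [[kp _] _]]; apply: (kernel_mono hL kp). Qed.

Lemma sub_modI X Y Q (i : Mor X Y) (p : Mor Y Q) :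
  mono i -> is_cokernel i p -> C Q -> sub_mod C i.
Proof.
move=> mi ci CQ; exists Q, p; do 2!split=> //.
have [Q' [p' [kp cp]]] := mono_short_exact hA mi.
apply: (is_kernelI mi); first by case: ci.
move=> W g pg0; apply: (kernel_fact kp).
have [t <-] := cokernel_fact ci (proj1 cp).
by rewrite -assoc pg0 (cmp0 hL).
Qed.

Lemma sub_mod_id X : sub_mod C \1_X.
Proof.
have [Z hZ] := ab_zero hA.
apply: (@sub_modI _ _ Z _ (0 : Mor X Z)); first exact: mono_id.
  apply: is_cokernelI.
  - by apply: (epiP0 hL) => W g _; rewrite (proj2 hZ _ g).
  - exact: cmp0l.
  - move=> W g; rewrite (lc_idr hL) => ->; exists 0; exact: cmp0.
exact: serre_zero.
Qed.

Lemma sub_mod_cmp X Y Z (j : Mor Y Z) (i : Mor X Y) :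
  sub_mod C j -> sub_mod C i -> sub_mod C (j ∘ i).
Proof.
move=> sj si; have mj := sub_mod_mono sj; have mi := sub_mod_mono si.
case: sj => Q [q [[kq cq] CQ]]; case: si => P [p [[kp cp] CP]].
have [R [r [kr cr]]] := mono_short_exact hA (mono_cmp hL mj mi).
apply: (sub_modI (mono_cmp hL mj mi) cr).
have [t tr] : exists t, t ∘ r = q.
  by apply: (cokernel_fact cr); rewrite assoc (proj1 cq) (cmp0l hL).
have [s sp] : exists s, s ∘ p = r ∘ j.
  by apply: (cokernel_fact cp); rewrite -assoc (proj1 kr).
have er := cokernel_epi hL cr; have eq := cokernel_epi hL cq.
have ep := cokernel_epi hL cp.
have et : epi t by apply: (@epi_cmpl _ _ hL _ _ _ t r); rewrite tr.
have ms : mono s.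
  apply: (monoP0 hL) => W g sg0.
  have [V [w [n [ew pn]]]] := epi_pullback hA g ep.
  have : r ∘ (j ∘ n) = 0.
    by rewrite assoc -sp -assoc pn assoc sg0 (cmp0l hL).
  case/(kernel_fact kr) => m; rewrite -assoc => /mj mn.
  apply: ew; rewrite -pn -mn assoc (proj1 kp) !(cmp0l hL) //.
apply: (serre_ext hC (i := s) (p := t) _ CP CQ); split.
  apply: (is_kernelI ms).
    by apply: ep; rewrite -assoc sp assoc tr (proj1 kq) (cmp0l hL).
  move=> W g tg0.
  have [V [w [n [ew rn]]]] := epi_pullback hA g er.
  have : q ∘ n = 0 by rewrite -tr -assoc rn assoc tg0 (cmp0l hL).
  case/(kernel_fact kq) => m jm.
  have [K [l [kl cl]]] := epi_short_exact hA ew.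
  have [h hw] : exists h, h ∘ w = p ∘ m.
    apply: (cokernel_fact cl); apply: ms.
    rewrite (cmp0 hL) !assoc sp -(assoc r j m) jm rn -assoc (proj1 kl).
    exact: cmp0.
  exists h; apply: ew; rewrite -assoc hw assoc sp -assoc jm; exact: rn.
apply: (is_cokernelI et).
  by apply: ep; rewrite -assoc sp assoc tr (proj1 kq) (cmp0l hL).
move=> W g gs0.
have [h hq] : exists h, h ∘ q = g ∘ r.
  apply: (cokernel_fact cq); rewrite -assoc -sp assoc gs0; exact: cmp0l.
by exists h; apply: er; rewrite -assoc tr.
Qed.

Lemma sub_mod_pullback X Y Z (m : Mor X Z) (f : Mor Y Z) : sub_mod C m ->
  exists W (u : Mor W Y) (a : Mor W X), sub_mod C u /\ m ∘ a = f ∘ u.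
Proof.
case=> Q [c [[kc cc] CQ]].
have [W [u hu]] := ab_kernel hA (c ∘ f).
have [a ma] : exists a, m ∘ a = f ∘ u.
  by apply: (kernel_fact kc); rewrite assoc (proj1 hu).
exists W, u, a; split=> //.
have mu := kernel_mono hL hu.
have [I [e [n [ee mn ne]]]] := image_fact hA (c ∘ f).
apply: (sub_modI mu) (serre_sub hC mn CQ).
have [K [j [kj cj]]] := epi_short_exact hA ee.
have eu0 : e ∘ u = 0 by apply: mn; rewrite (cmp0 hL) assoc ne (proj1 hu).
apply: (is_cokernelI ee eu0) => V g gu0; apply: (cokernel_fact cj).
have [x <-] : exists x, u ∘ x = j.
  by apply: (kernel_fact hu); rewrite -ne -assoc (proj1 kj) (cmp0 hL).
by rewrite assoc gu0 (cmp0l hL).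
Qed.

Lemma sub_mod_image X Y Z I (p : Mor Y Z) (j : Mor X Y) (e : Mor X I)
    (m : Mor I Z) :
  epi p -> sub_mod C j -> mono m -> m ∘ e = p ∘ j -> sub_mod C m.
Proof.
move=> ep [Q [q [[kq cq] CQ]]] mm me.
have [R [r [kr cr]]] := mono_short_exact hA mm.
apply: (sub_modI mm cr).
have [t tq] : exists t, t ∘ q = r ∘ p.
  by apply: (cokernel_fact cq); rewrite -assoc -me assoc (proj1 kr) (cmp0l hL).
apply: (serre_quo hC (p := t)) CQ.
apply: (@epi_cmpl _ _ hL _ _ _ t q); rewrite tq.
exact: (epi_cmp hL (cokernel_epi hL cr) ep).
Qed.

Lemma sub_mod_cmpr X Y Z (i : Mor Y Z) (u : Mor X Y) :
  mono i -> sub_mod C (i ∘ u) -> sub_mod C u.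
Proof.
move=> mi siu; have [W [u' [a [su' e]]]] := sub_mod_pullback i siu.
refine (@sub_mod_image W Y Y X \1_Y u' a u (@epi_id _ _ hL Y) su' _ _).
  exact: (mono_cmpr hL (sub_mod_mono siu)).
by rewrite (lc_idl hL); apply: mi; rewrite assoc.
Qed.

Lemma sub_mod_meet X Y Z (i : Mor X Z) (j : Mor Y Z) :
  sub_mod C i -> sub_mod C j ->
  exists W (u : Mor W X) (v : Mor W Y), sub_mod C (i ∘ u) /\ i ∘ u = j ∘ v.
Proof.
move=> si sj; have [W [u [v [su e]]]] := sub_mod_pullback i sj.
by exists W, u, v; split=> //; apply: sub_mod_cmp.
Qed.

End SerreSub.

Section SerreQuo.
Variables (k : fieldType) (A : catData k) (hA : abelian A).
Variables (C : A -> Prop) (hC : serre C).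
Implicit Types X Y Z W : A.
Let hO := abelian_op hA.
Let hCO := serre_op hC.

Lemma quo_sub_op X Y (p : Mor X Y) : quo_mod C p <-> @sub_mod _ (opcat A) C Y X p.
Proof. by split; case=> Q [i [[h1 h2] hQ]]; exists Q, i; split. Qed.

Lemma quo_mod_epi X Y (p : Mor X Y) : quo_mod C p -> epi p.
Proof. by move/quo_sub_op; apply: (sub_mod_mono hO). Qed.

Lemma quo_mod_id X : quo_mod C \1_X.
Proof. exact/quo_sub_op/(sub_mod_id hO hCO). Qed.

Lemma quo_mod_cmp X Y Z (q : Mor Y Z) (p : Mor X Y) :
  quo_mod C q -> quo_mod C p -> quo_mod C (q ∘ p).
Proof.
move=> /quo_sub_op hq /quo_sub_op hp; apply/quo_sub_op.
exact: (sub_mod_cmp hO hCO hp hq).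
Qed.

Lemma quo_mod_pushout X Y Z (e : Mor Z X) (f : Mor Z Y) : quo_mod C e ->
  exists W (v : Mor Y W) (b : Mor X W), quo_mod C v /\ b ∘ e = v ∘ f.
Proof.
move=> /quo_sub_op he.
have [W [v [b [hv E]]]] :=
  @sub_mod_pullback _ _ hO _ hCO X Y Z e f he.
by exists W, v, b; split=> //; apply/quo_sub_op.
Qed.

Lemma quo_mod_image X Y Z I (p : Mor Y Z) (j : Mor X Y) (e : Mor X I)
    (m : Mor I Z) :
  quo_mod C p -> mono j -> epi e -> m ∘ e = p ∘ j -> quo_mod C e.
Proof.
move=> /quo_sub_op hp mj ee me; apply/quo_sub_op.
exact: (@sub_mod_image _ _ hO _ hCO Z Y X I j p m e).
Qed.

Lemma quo_mod_cmpl X Y Z (w : Mor Y Z) (p : Mor X Y) :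
  epi p -> quo_mod C (w ∘ p) -> quo_mod C w.
Proof.
move=> ep /quo_sub_op h; apply/quo_sub_op.
exact: (@sub_mod_cmpr _ _ hO _ hCO Z Y X p w).
Qed.

Lemma quo_mod_meet X Y Z (p : Mor Z X) (q : Mor Z Y) :
  quo_mod C p -> quo_mod C q ->
  exists W (u : Mor X W) (v : Mor Y W), quo_mod C (u ∘ p) /\ u ∘ p = v ∘ q.
Proof.
move=> /quo_sub_op hp /quo_sub_op hq.
have [W [u [v [h E]]]] := @sub_mod_meet _ _ hO _ hCO X Y Z p q hp hq.
by exists W, u, v; split=> //; apply/quo_sub_op.
Qed.

End SerreQuo.

Section Quotient.
Variables (k : fieldType) (A : catData k) (hA : abelian A).
Variables (C : A -> Prop) (hC : serre C).
Implicit Types M N P : A.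
Let hL := ab_linear hA.
Let assoc := lc_assoc hL.

(* The indices of the direct system defining Hom_{A/C}(M,N): subobjects
   M' = qsrc of M with M/M' in C and quotients N/N' = qtgt of N with N' in C. *)
Record qindex M N := QIndex {
  qsrc : A;
  qtgt : A;
  qinc : Mor qsrc M;
  qprj : Mor N qtgt;
  qincP : sub_mod C qinc;
  qprjP : quo_mod C qprj }.

(* f : M' -> N/N' has image g : M'' -> N/N'' under the transition map of the
   direct system from the index s to the finer index t *)
Definition restricts M N (s : qindex M N) (f : Mor (qsrc s) (qtgt s))
    (t : qindex M N) (g : Mor (qsrc t) (qtgt t)) : Prop :=
  exists (u : Mor (qsrc t) (qsrc s)) (v : Mor (qtgt s) (qtgt t)),
    [/\ qinc s ∘ u = qinc t, v ∘ qprj s = qprj t & v ∘ f ∘ u = g].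

Definition finer M N (s t : qindex M N) : Prop :=
  exists (u : Mor (qsrc t) (qsrc s)) (v : Mor (qtgt s) (qtgt t)),
    qinc s ∘ u = qinc t /\ v ∘ qprj s = qprj t.

Definition roof M N := {s : qindex M N & Mor (qsrc s) (qtgt s)}.

HB.instance Definition _ M N := gen_eqMixin (roof M N).
HB.instance Definition _ M N := gen_choiceMixin (roof M N).

Definition roof_eq M N (f g : roof M N) : Prop :=
  exists t h, @restricts M N (projT1 f) (projT2 f) t h /\
              @restricts M N (projT1 g) (projT2 g) t h.

Lemma restricts_ex M N (s t : qindex M N) f : finer s t ->
  exists g, @restricts M N s f t g.
Proof. by case=> u [v [? ?]]; exists (v ∘ f ∘ u), u, v. Qed.

Lemma restricts_uniq M N (s t : qindex M N) f g g' :
  @restricts M N s f t g -> @restricts M N s f t g' -> g = g'.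
Proof.
case=> u [v [hu hv <-]] [u' [v' [hu' hv' <-]]].
have -> : u = u' by apply: (sub_mod_mono hA (qincP s)); rewrite hu hu'.
have -> // : v = v' by apply: (quo_mod_epi hA (qprjP s)); rewrite hv hv'.
Qed.

Lemma restricts_refl M N (s : qindex M N) f : restricts f (t := s) f.
Proof.
by exists \1_(qsrc s), \1_(qtgt s); split;
   rewrite ?(lc_idl hL) ?(lc_idr hL) // (lc_idl hL).
Qed.

Lemma restricts_trans M N (r s t : qindex M N) f g h :
  @restricts M N r f s g -> @restricts M N s g t h -> @restricts M N r f t h.
Proof.
case=> u [v [hu hv <-]] [u' [v' [hu' hv' <-]]].
exists (u ∘ u'), (v' ∘ v); split.
- by rewrite assoc hu.
- by rewrite -assoc hv.
- by rewrite !assoc.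
Qed.

Lemma restricts_finer M N (s t : qindex M N) f g :
  @restricts M N s f t g -> finer s t.
Proof. by case=> u [v [? ? _]]; exists u, v. Qed.

Lemma finer_directed M N (s t : qindex M N) :
  exists r, finer s r /\ finer t r.
Proof.
have [W [u [u' [hu eu]]]] := sub_mod_meet hA hC (qincP s) (qincP t).
have [V [v [v' [hv ev]]]] := quo_mod_meet hA hC (qprjP s) (qprjP t).
by exists (QIndex hu hv); split; [exists u, v | exists u', v'].
Qed.

Lemma roof_eq_refl M N : forall f, @roof_eq M N f f.
Proof.
by case=> s f; exists s, f; split; apply: restricts_refl.
Qed.

Lemma roof_eq_sym M N : forall f g, @roof_eq M N f g -> roof_eq g f.
Proof. by move=> f g [t [h [? ?]]]; exists t, h. Qed.

Lemma roof_eq_trans M N :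
  forall g f h, @roof_eq M N f g -> roof_eq g h -> roof_eq f h.
Proof.
move=> g f h [s [a [fa ga]]] [t [b [gb hb]]].
have [r [sr tr]] := finer_directed s t.
have [a' ha'] := restricts_ex a sr; have [b' hb'] := restricts_ex b tr.
have e := restricts_uniq (restricts_trans ga ha') (restricts_trans gb hb').
exists r, a'; split; first exact: restricts_trans ha'.
by rewrite e; apply: restricts_trans hb'.
Qed.

Definition roof_eqb M N : rel (roof M N) := fun f g => `[< roof_eq f g >].

Lemma roof_equiv M N : equiv_class_of (@roof_eqb M N).
Proof.
split.
- by move=> f; apply/asboolP/roof_eq_refl.
- by move=> f g; apply/asboolP/asboolP; apply: roof_eq_sym.
- move=> g f h /asboolP fg /asboolP gh; apply/asboolP.
  exact: roof_eq_trans gh.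
Qed.

Canonical roof_equiv_rel M N := EquivRelPack (@roof_equiv M N).

(* Hom_{A/C}(M,N), the direct limit of the spaces Hom(M', N/N') *)
Definition qhom M N := {eq_quot (@roof_equiv_rel M N)}.
HB.instance Definition _ M N := Choice.on (qhom M N).

(* The morphism of A/C represented by f : M' -> N/N' *)
Definition qclass M N (s : qindex M N) (f : Mor (qsrc s) (qtgt s)) : qhom M N :=
  \pi_(qhom M N) (existT _ s f : roof M N).

Lemma qclass_eq M N (s t : qindex M N) f g :
  @qclass M N s f = @qclass M N t g <->
  exists r h, restricts f (t := r) h /\ restricts g (t := r) h.
Proof. by split=> [/eqmodP/asboolP //|h]; apply/eqmodP/asboolP. Qed.

Lemma qclassP M N (x : qhom M N) : exists s f, x = @qclass M N s f.
Proof.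
by case: (repr x) (reprK x) => s f <-; exists s, f.
Qed.

Lemma qclass_restricts M N (s t : qindex M N) f g :
  @restricts M N s f t g -> qclass f = qclass g.
Proof.
by move=> h; apply/qclass_eq; exists t, g; split=> //; apply: restricts_refl.
Qed.

Lemma qclass_finer M N (s t : qindex M N) f : finer s t ->
  exists g, @qclass M N s f = @qclass M N t g.
Proof.
by case/(restricts_ex f) => g /qclass_restricts; exists g.
Qed.

Lemma qclass2P M N (x y : qhom M N) :
  exists s f g, x = @qclass M N s f /\ y = @qclass M N s g.
Proof.
have [s [f ->]] := qclassP x; have [t [g ->]] := qclassP y.
have [r [sr tr]] := finer_directed s t.
have [f' ->] := qclass_finer f sr; have [g' ->] := qclass_finer g tr.
by exists r, f', g'.
Qed.

Lemma qclass3P M N (x y z : qhom M N) :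
  exists s f g h, [/\ x = @qclass M N s f, y = @qclass M N s g
                    & z = @qclass M N s h].
Proof.
have [s [f [g [-> ->]]]] := qclass2P x y; have [t [h ->]] := qclassP z.
have [r [sr tr]] := finer_directed s t.
have [f' ->] := qclass_finer f sr; have [g' ->] := qclass_finer g sr.
by have [h' ->] := qclass_finer h tr; exists r, f', g', h'.
Qed.

Definition qindex_id M N : qindex M N :=
  QIndex (sub_mod_id hA hC M) (quo_mod_id hA hC N).

(* The canonical functor T : A -> A/C on morphisms *)
Definition qT M N (f : Mor M N) : qhom M N := @qclass M N (qindex_id M N) f.

(* Sums, composites and tensor products of classes are chosen among the values
   obtained from all representatives; these values coincide, see [qaddE],
   [is_qcomp_uniq] and [is_qtens_uniq]. *)
Definition is_qadd M N (x y z : qhom M N) : Prop :=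
  exists s f g, [/\ x = @qclass M N s f, y = qclass g & z = qclass (f + g)].

Lemma is_qadd_ex M N (x y : qhom M N) : exists z, is_qadd x y z.
Proof.
by have [s [f [g [-> ->]]]] := qclass2P x y; exists (qclass (f + g)), s, f, g.
Qed.

Definition qadd M N (x y : qhom M N) := projT1 (cid (is_qadd_ex x y)).
Definition qscale M N (c : k) (x : qhom M N) : qhom M N :=
  qclass (c *: projT2 (repr x)).
Definition qopp M N (x : qhom M N) : qhom M N := qscale (-1) x.
Definition qzero M N : qhom M N := qT 0.

Lemma restrictsD M N (s t : qindex M N) f f' g g' :
  @restricts M N s f t g -> @restricts M N s f' t g' ->
  @restricts M N s (f + f') t (g + g').
Proof.
move=> h h'; case: (restricts_finer h) => u [v [hu hv]].
have -> : g = v ∘ f ∘ u by apply: (restricts_uniq h); exists u, v.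
have -> : g' = v ∘ f' ∘ u by apply: (restricts_uniq h'); exists u, v.
by exists u, v; rewrite (cmpDr hL) (cmpDl hL).
Qed.

Lemma restrictsZ M N (s t : qindex M N) c f g :
  @restricts M N s f t g -> @restricts M N s (c *: f) t (c *: g).
Proof.
case=> u [v [hu hv <-]]; exists u, v; split=> //.
by rewrite (cmpZr hL) (cmpZl hL).
Qed.

Lemma restricts0 M N (s t : qindex M N) : finer s t ->
  @restricts M N s 0 t 0.
Proof.
case=> u [v [hu hv]]; exists u, v; split=> //.
by rewrite (cmp0 hL) (cmp0l hL).
Qed.

Lemma qaddE M N (s : qindex M N) f g :
  qadd (@qclass M N s f) (qclass g) = qclass (f + g).
Proof.
rewrite /qadd; case: cid => z /= [t [f' [g' [/qclass_eq ef /qclass_eq eg ->]]]].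
case: ef => r [l [fl fl']]; case: eg => q [m [gm gm']].
have [w [rw qw]] := finer_directed r q.
have [l' ll'] := restricts_ex l rw; have [m' mm'] := restricts_ex m qw.
apply/qclass_eq; exists w, (l' + m'); split; apply: restrictsD;
  by [apply: restricts_trans ll' | apply: restricts_trans mm'].
Qed.

Lemma qscaleE M N c (s : qindex M N) f :
  qscale c (@qclass M N s f) = qclass (c *: f).
Proof.
rewrite /qscale; have := reprK (@qclass M N s f).
case: (repr _) => t g /= /qclass_eq [r [h [h1 h2]]].
by apply/qclass_eq; exists r, (c *: h); split; apply: restrictsZ.
Qed.

Lemma qclass0 M N (s : qindex M N) : @qclass M N s 0 = qzero M N.
Proof.
have [r [sr ir]] := finer_directed s (qindex_id M N).
by apply/qclass_eq; exists r, 0; split; apply: restricts0.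
Qed.

Lemma qaddA M N : associative (@qadd M N).
Proof.
move=> x y z; have [s [f [g [h [-> -> ->]]]]] := qclass3P x y z.
by rewrite !qaddE addrA.
Qed.

Lemma qaddC M N : commutative (@qadd M N).
Proof.
move=> x y; have [s [f [g [-> ->]]]] := qclass2P x y.
by rewrite !qaddE addrC.
Qed.

Lemma qadd0 M N : left_id (qzero M N) (@qadd M N).
Proof.
by move=> x; have [s [f ->]] := qclassP x; rewrite -(qclass0 s) qaddE add0r.
Qed.

Lemma qaddN M N : left_inverse (qzero M N) (@qopp M N) (@qadd M N).
Proof.
move=> x; have [s [f ->]] := qclassP x.
by rewrite /qopp qscaleE qaddE scaleN1r addNr qclass0.
Qed.

HB.instance Definition _ M N := GRing.isZmodule.Build (qhom M N)
  (@qaddA M N) (@qaddC M N) (@qadd0 M N) (@qaddN M N).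

Lemma qclassD M N (s : qindex M N) f g :
  @qclass M N s (f + g) = qclass f + qclass g.
Proof. exact: esym (qaddE f g). Qed.

Lemma qscaleA M N a b (x : qhom M N) :
  qscale a (qscale b x) = qscale (a * b) x.
Proof. by have [s [f ->]] := qclassP x; rewrite !qscaleE scalerA. Qed.

Lemma qscale1 M N : left_id 1 (@qscale M N).
Proof. by move=> x; have [s [f ->]] := qclassP x; rewrite qscaleE scale1r. Qed.

Lemma qscaleDr M N : right_distributive (@qscale M N) +%R.
Proof.
move=> a x y; have [s [f [g [-> ->]]]] := qclass2P x y.
by rewrite -qclassD !qscaleE -qclassD scalerDr.
Qed.

Lemma qscaleDl M N (x : qhom M N) : {morph (@qscale M N)^~ x : a b / a + b}.
Proof.
by move=> a b; have [s [f ->]] := qclassP x; rewrite !qscaleE -qclassD scalerDl.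
Qed.

HB.instance Definition _ M N := GRing.Zmodule_isLmodule.Build k (qhom M N)
  (@qscaleA M N) (@qscale1 M N) (@qscaleDr M N) (@qscaleDl M N).

Lemma qclassZ M N c (s : qindex M N) f :
  @qclass M N s (c *: f) = c *: qclass f.
Proof. exact: esym (qscaleE c f). Qed.

(* If f : M' -> N/N' and g : N'' -> P/P', the composite of the represented
   morphisms is represented by h : M'' -> I -> P/P'', where
   I = N''/(N' ∩ N'') is the image of N'' in N/N', where M'' is a subobject of
   M' which f maps into I, and where P/P'' is a quotient of P/P' such that the
   composition of g with P/P' -> P/P'' factors through N'' -> I. *)
Definition composite M N P (s : qindex M N) (f : Mor (qsrc s) (qtgt s))
    (t : qindex N P) (g : Mor (qsrc t) (qtgt t))
    (r : qindex M P) (h : Mor (qsrc r) (qtgt r)) : Prop :=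
  exists (I : A) (e : Mor (qsrc t) I) (m : Mor I (qtgt s))
    (u : Mor (qsrc r) (qsrc s)) (a : Mor (qsrc r) I)
    (v : Mor (qtgt t) (qtgt r)) (b : Mor I (qtgt r)),
  [/\ [/\ epi e, mono m & m ∘ e = qprj s ∘ qinc t],
      qinc s ∘ u = qinc r /\ m ∘ a = f ∘ u,
      v ∘ qprj t = qprj r /\ b ∘ e = v ∘ g
    & h = b ∘ a].

Lemma composite_ex M N P (s : qindex M N) f (t : qindex N P) g :
  exists r h, @composite M N P s f t g r h.
Proof.
have [I [e [m [ee mm me]]]] := image_fact hA (qprj s ∘ qinc t).
have sm := sub_mod_image hA hC (quo_mod_epi hA (qprjP s)) (qincP t) mm me.
have qe := quo_mod_image hA hC (qprjP s) (sub_mod_mono hA (qincP t)) ee me.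
have [W [u [a [su ma]]]] := sub_mod_pullback hA hC f sm.
have [V [v [b [qv be]]]] := quo_mod_pushout hA hC g qe.
exists (QIndex (sub_mod_cmp hA hC (qincP s) su) (quo_mod_cmp hA hC qv (qprjP t))).
by exists (b ∘ a), I, e, m, u, a, v, b.
Qed.

Lemma composite_restricts M N P
    (s : qindex M N) f (t : qindex N P) g r h
    (s0 : qindex M N) f0 (t0 : qindex N P) g0 r0 h0 :
  @restricts M N s f s0 f0 -> @restricts N P t g t0 g0 ->
  @composite M N P s f t g r h -> @composite M N P s0 f0 t0 g0 r0 h0 ->
  qclass h = qclass h0.
Proof.
case=> z [w [hz hw <-]] [y [x [hy hx <-]]].
case=> I [e [m [u [a [v [b [[ee mm me] [iu ma] [vp be] ->]]]]]]].
case=> I0 [e0 [m0 [u0 [a0 [v0 [b0 [[ee0 mm0 me0] [iu0 ma0] [vp0 be0] ->]]]]]]].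
have [q [[p [d [hp hd]]] [p0 [d0 [hp0 hd0]]]]] := finer_directed r r0.
have eup : u ∘ p = z ∘ u0 ∘ p0.
  apply: (sub_mod_mono hA (qincP s)).
  by rewrite !assoc hz iu iu0 hp hp0.
have edv : d ∘ v = d0 ∘ v0 ∘ x.
  apply: (quo_mod_epi hA (qprjP t)).
  by rewrite -!assoc hx vp vp0 hd hd0.
have qw : quo_mod C w.
  apply: (quo_mod_cmpl hA hC (quo_mod_epi hA (qprjP s))).
  rewrite hw; exact: qprjP.
have [I2 [e2 [m2 [ee2 mm2 me2]]]] := image_fact hA (w ∘ m).
have qe2 := quo_mod_image hA hC qw mm ee2 me2.
have [V [c [b' [qc be2]]]] := quo_mod_pushout hA hC (d ∘ b) qe2.
have [W [ω [n [eω en]]]] := epi_pullback hA (a0 ∘ p0) ee0.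
have mid : w ∘ m ∘ (a ∘ p ∘ ω) = w ∘ m ∘ (e ∘ y ∘ n).
  transitivity (m0 ∘ (e0 ∘ n)).
    rewrite en !assoc ma0 -(assoc w m a) ma.
    by rewrite -!assoc (assoc u p ω) eup !assoc.
  by rewrite !assoc me0 -hw -(assoc w m e) me -hy !assoc.
have fin : c ∘ d ∘ b ∘ (a ∘ p ∘ ω) = c ∘ d ∘ b ∘ (e ∘ y ∘ n).
  rewrite -(assoc c d b) -be2 -!(assoc b' e2); congr (_ ∘ _).
  by apply: mm2; rewrite !(assoc m2) me2.
apply/qclass_eq; exists (QIndex (qincP q) (quo_mod_cmp hA hC qc (qprjP q))).
exists (c ∘ d ∘ b ∘ a ∘ p); split; first by exists p, (c ∘ d); split;
  rewrite -?assoc ?hp ?hd.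
exists p0, (c ∘ d0); split=> //=; first by rewrite -assoc hd0.
rewrite assoc.
apply: eω; symmetry; transitivity (c ∘ d ∘ b ∘ (a ∘ p ∘ ω)).
  by rewrite !assoc.
rewrite fin.
transitivity (c ∘ d0 ∘ b0 ∘ (a0 ∘ p0 ∘ ω)); last by rewrite !assoc.
rewrite -en !assoc -(assoc (c ∘ d) b e) be -(assoc (c ∘ d0) b0 e0) be0.
by rewrite !assoc -(assoc c d v) edv !assoc.
Qed.

Definition is_qcomp M N P (y : qhom N P) (x : qhom M N) (z : qhom M P) : Prop :=
  exists s f t g r h, [/\ x = @qclass M N s f, y = @qclass N P t g,
    z = @qclass M P r h & composite f g h].

Lemma is_qcomp_ex M N P (y : qhom N P) (x : qhom M N) :
  exists z, is_qcomp y x z.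
Proof.
have [s [f ->]] := qclassP x; have [t [g ->]] := qclassP y.
have [r [h H]] := composite_ex f g.
by exists (qclass h), s, f, t, g, r, h.
Qed.

Lemma is_qcomp_uniq M N P (y : qhom N P) (x : qhom M N) z z' :
  is_qcomp y x z -> is_qcomp y x z' -> z = z'.
Proof.
case=> s [f [t [g [r [h [-> -> -> H]]]]]].
case=> s' [f' [t' [g' [r' [h' [/qclass_eq ex /qclass_eq ey -> H']]]]]].
case: ex => s0 [f0 [sf sf']]; case: ey => t0 [g0 [tg tg']].
have [r0 [h0 H0]] := composite_ex f0 g0.
by rewrite (composite_restricts sf tg H H0) (composite_restricts sf' tg' H' H0).
Qed.

Definition qcmp M N P (y : qhom N P) (x : qhom M N) : qhom M P :=
  projT1 (cid (is_qcomp_ex y x)).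

Lemma qcmpE M N P s f t g r h : @composite M N P s f t g r h ->
  qcmp (qclass g) (qclass f) = qclass h.
Proof.
move=> H; rewrite /qcmp; case: cid => z /= hz; apply: (is_qcomp_uniq hz).
by exists s, f, t, g, r, h.
Qed.

Definition quocat : catData k :=
  @CatData k A (fun M N => qhom M N) (fun M => qT \1_M) qcmp.

End Quotient.

Section Adjunction.
Variables (k : fieldType) (A : monData k).
Hypotheses (hL : linear_category A) (hM : monoidal A) (hB : tens_bilinear A).
Implicit Types X Y Z W D : A.
Let assoc := lc_assoc hL.

Lemma tensm_cmpl X Y Z W (g : Mor Y Z) (f : Mor X Y) :
  (g ∘ f) ⊠ \1_W = g ⊠ \1_W ∘ f ⊠ \1_W.
Proof. by rewrite -(mo_cmp hM) (lc_idl hL). Qed.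

Lemma tensm_cmpr X Y Z W (g : Mor Y Z) (f : Mor X Y) :
  \1_W ⊠ (g ∘ f) = \1_W ⊠ g ∘ \1_W ⊠ f.
Proof. by rewrite -(mo_cmp hM) (lc_idl hL). Qed.

Lemma tensm0l X Y Z W (f : Mor X Y) : (0 : Mor Z W) ⊠ f = 0.
Proof.
by rewrite -[0](addNr 0) -scaleN1r (proj1 hB) scaleN1r addNr.
Qed.

Lemma inverse_tens X X' Y Y' (f : Mor X X') f' (g : Mor Y Y') g' :
  is_inverse f f' -> is_inverse g g' -> is_inverse (f ⊠ g) (f' ⊠ g').
Proof.
case=> f1 f2 [g1 g2]; split; rewrite -(mo_cmp hM) ?f1 ?f2 ?g1 ?g2;
  exact: mo_id.
Qed.

Lemma inverse_cmp X Y Z (g : Mor Y Z) g' (f : Mor X Y) f' :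
  is_inverse g g' -> is_inverse f f' -> is_inverse (g ∘ f) (f' ∘ g').
Proof.
case=> g1 g2 [f1 f2]; split.
  by rewrite assoc -(assoc f') g1 (lc_idr hL).
by rewrite assoc -(assoc g) f2 (lc_idr hL).
Qed.

Lemma inverse_uniq X Y (f : Mor X Y) g g' :
  is_inverse f g -> is_inverse f g' -> g = g'.
Proof.
by case=> g1 g2 [g1' g2']; rewrite -[g](lc_idr hL) -g2' assoc g1 (lc_idl hL).
Qed.

Lemma inverse_id X : is_inverse \1_X \1_X.
Proof. by split; rewrite (lc_idl hL). Qed.

Lemma inverse_conj X Y X' Y' (p : Mor X X') p' (q : Mor Y Y') q' f g :
  is_inverse p p' -> is_inverse q q' -> q ∘ f = g ∘ p -> f ∘ p' = q' ∘ g.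
Proof.
move=> [p1 p2] [q1 q2] e.
by rewrite -[f](lc_idl hL) -q1 -(assoc q') e -!assoc p2 (lc_idr hL).
Qed.

Lemma runit_tens X Y : \1_X ⊠ runitm Y ∘ assocm X Y 𝟙 = runitm (X ⊗ Y).
Proof.
have faith Z W (f g : Mor Z W) : f ⊠ \1_𝟙 = g ⊠ \1_𝟙 -> f = g.
  move=> e; have [r [r1 r2]] := mo_runit_iso hM Z.
  rewrite -[f](lc_idr hL) -[g](lc_idr hL) -r2 !assoc.
  by rewrite -!(mo_runit_nat hM) e.
apply: faith; have [b [b1 b2]] := mo_assoc_iso hM X Y 𝟙.
suff e : assocm X Y 𝟙 ∘ (\1_X ⊠ runitm Y ∘ assocm X Y 𝟙) ⊠ \1_𝟙
       = assocm X Y 𝟙 ∘ runitm (X ⊗ Y) ⊠ \1_𝟙.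
  by rewrite -[LHS](lc_idl hL) -[RHS](lc_idl hL) -b1 -!assoc e.
rewrite tensm_cmpl assoc (mo_assoc_nat hM) -(mo_triangle hM Y) tensm_cmpr.
rewrite -!assoc (assoc (\1_X ⊠ assocm _ _ _)) -(mo_pentagon hM) !assoc.
by rewrite -(mo_assoc_nat hM) (mo_id hM) -assoc (mo_triangle hM).
Qed.

Variables (D X : A) (ev : Mor (D ⊗ X) 𝟙) (coev : Mor 𝟙 (X ⊗ D)).
Hypothesis zigzag :
  runitm X ∘ \1_X ⊠ ev ∘ assocm X D X ∘ coev ⊠ \1_X = lunitm X.

Lemma tens_transpose : exists phi : forall Y Z, Mor (Y ⊗ X) Z -> Mor Y (Z ⊗ D),
  exists chi : forall Y Z, Mor Y (Z ⊗ D) -> Mor (Y ⊗ X) Z,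
  [/\ forall Y Y' Z (f : Mor (Y ⊗ X) Z) (g : Mor Y' Y),
        phi _ _ (f ∘ g ⊠ \1_X) = phi _ _ f ∘ g,
      forall Y Y' Z (f : Mor Y (Z ⊗ D)) (g : Mor Y' Y),
        chi _ _ (f ∘ g) = chi _ _ f ∘ g ⊠ \1_X,
      forall Y Z f, chi Y Z (phi _ _ f) = f,
      forall Y Z, phi Y Z 0 = 0 & forall Y Z, chi Y Z 0 = 0].
Proof.
pose ai Y := projT1 (cid (mo_assoc_iso hM Y X D)).
have aiP Y : is_inverse (assocm Y X D) (ai Y) := projT2 (cid (mo_assoc_iso hM Y X D)).
pose ri Y := projT1 (cid (mo_runit_iso hM Y)).
have riP Y : is_inverse (runitm Y) (ri Y) := projT2 (cid (mo_runit_iso hM Y)).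
exists (fun Y Z f => f ⊠ \1_D ∘ ai Y ∘ \1_Y ⊠ coev ∘ ri Y).
exists (fun Y Z h => runitm Z ∘ \1_Z ⊠ ev ∘ assocm Z D X ∘ h ⊠ \1_X).
split=> [Y Y' Z f g|Y Y' Z f g|Y Z f|Y Z|Y Z].
- rewrite tensm_cmpl -!assoc; congr (_ ∘ _).
  have <- := inverse_conj (riP Y') (riP Y) (mo_runit_nat hM g).
  rewrite !assoc -(assoc _ (\1_Y ⊠ coev)) -(mo_cmp hM) (lc_idl hL) (lc_idr hL).
  have nat := mo_assoc_nat hM g \1_X \1_D.
  rewrite (inverse_conj (aiP Y') (aiP Y) nat) (mo_id hM) -(assoc (ai Y)).
  by rewrite -(mo_cmp hM) (lc_idl hL) (lc_idr hL).
- by rewrite tensm_cmpl !assoc.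
- have [li liP] := mo_lunit_iso hM X.
  have [a' aP'] := mo_assoc_iso hM Y X (D ⊗ X).
  rewrite !tensm_cmpl !assoc.
  have -> : runitm Z ∘ \1_Z ⊠ ev ∘ assocm Z D X ∘ (f ⊠ \1_D) ⊠ \1_X
      = f ∘ (runitm (Y ⊗ X) ∘ \1_(Y ⊗ X) ⊠ ev ∘ assocm (Y ⊗ X) D X).
    rewrite -assoc (mo_assoc_nat hM) !assoc -(mo_runit_nat hM).
    rewrite -(assoc _ (\1_Z ⊠ ev)) -(assoc _ (f ⊠ \1_𝟙)) -!(mo_cmp hM).
    by rewrite (mo_id hM) !(lc_idl hL) !(lc_idr hL).
  have h2 : assocm (Y ⊗ X) D X ∘ ai Y ⊠ \1_X
      = a' ∘ (\1_Y ⊠ assocm X D X ∘ assocm Y (X ⊗ D) X).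
    apply: (inverse_conj (inverse_tens (aiP Y) (inverse_id X)) aP').
    exact: mo_pentagon.
  have h3 : runitm (Y ⊗ X) ∘ \1_(Y ⊗ X) ⊠ ev ∘ a'
      = \1_Y ⊠ (runitm X ∘ \1_X ⊠ ev).
    rewrite -runit_tens -(mo_id hM) -(assoc _ (assocm _ _ _)) (mo_assoc_nat hM).
    by rewrite -!assoc (proj2 aP') (lc_idr hL) tensm_cmpr.
  have h4 : assocm Y (X ⊗ D) X ∘ (\1_Y ⊠ coev) ⊠ \1_X ∘ ri Y ⊠ \1_X
      = \1_Y ⊠ (coev ⊠ \1_X ∘ li).
    rewrite (mo_assoc_nat hM) tensm_cmpr -!assoc; congr (_ ∘ _).
    have := inverse_conj (inverse_tens (riP Y) (inverse_id X))
      (inverse_tens (inverse_id Y) liP) (f := assocm Y 𝟙 X) (g := \1_(Y ⊗ X)).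
    by rewrite (mo_triangle hM) (lc_idl hL) (lc_idr hL); apply.
  rewrite -!(assoc f) -(assoc _ (assocm _ _ _)) h2 !assoc -!(assoc f) h3.
  rewrite -!(assoc (\1_Y ⊠ (runitm X ∘ \1_X ⊠ ev) ∘ \1_Y ⊠ assocm X D X)) h4.
  rewrite -!assoc -!tensm_cmpr !assoc zigzag (proj2 liP) (mo_id hM).
  exact: lc_idr.
- by rewrite tensm0l !(cmp0l hL).
- by rewrite tensm0l !(cmp0 hL).
Qed.

Lemma tens_cokernel Y Y' Q (i : Mor Y' Y) (p : Mor Y Q) :
  is_cokernel i p -> is_cokernel (i ⊠ \1_X) (p ⊠ \1_X).
Proof.
have [phi [chi [hphi hchi K phi0 chi0]]] := tens_transpose.
move=> hp; have ep := cokernel_epi hL hp.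
apply: is_cokernelI.
- apply: (epiP0 hL) => Z g g0.
  rewrite -[g]K; suff -> : phi _ _ g = 0 by [].
  by apply: ep; rewrite -hphi g0 phi0 (cmp0l hL).
- by rewrite -tensm_cmpl (proj1 hp) tensm0l.
- move=> Z g g0; have [h hh] : exists h, h ∘ p = phi _ _ g.
    by apply: (cokernel_fact hp); rewrite -hphi g0.
  by exists (chi _ _ h); rewrite -hchi hh.
Qed.

End Adjunction.

Section Reversal.
Variables (k : fieldType) (A : monData k).
Hypotheses (hL : linear_category A) (hM : monoidal A) (hB : tens_bilinear A).
Implicit Types X Y Z W D : A.
Let assoc := lc_assoc hL.

Let ai X Y Z := projT1 (cid (mo_assoc_iso hM X Y Z)).
Let aiP X Y Z : is_inverse (assocm X Y Z) (ai X Y Z) :=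
  projT2 (cid (mo_assoc_iso hM X Y Z)).
Let ri X := projT1 (cid (mo_runit_iso hM X)).
Let riP X : is_inverse (runitm X) (ri X) := projT2 (cid (mo_runit_iso hM X)).
Let li X := projT1 (cid (mo_lunit_iso hM X)).
Let liP X : is_inverse (lunitm X) (li X) := projT2 (cid (mo_lunit_iso hM X)).

Let inverseC X Y (f : Mor X Y) g : is_inverse f g -> is_inverse g f.
Proof. by case. Qed.

Let pentagon_inv W X Y Z :
  ai (W ⊗ X) Y Z ∘ ai W X (Y ⊗ Z)
  = ai W X Y ⊠ \1_Z ∘ ai W (X ⊗ Y) Z ∘ \1_W ⊠ ai X Y Z.
Proof.
have i1 := inverse_cmp hL (aiP W X (Y ⊗ Z)) (aiP (W ⊗ X) Y Z).
have i2 := inverse_cmp hL (inverse_cmp hL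
  (inverse_tens hM (inverse_id hL W) (aiP X Y Z)) (aiP W (X ⊗ Y) Z))
  (inverse_tens hM (aiP W X Y) (inverse_id hL Z)).
rewrite -(mo_pentagon hM) in i2; rewrite (inverse_uniq hL i1 i2).
by rewrite assoc.
Qed.

Definition revmon : monData k :=
  @MonData k A (fun X Y => Y ⊗ X) (fun X X' Y Y' f g => g ⊠ f) 𝟙
    (fun X Y Z => ai Z Y X) (fun X => runitm X) (fun X => lunitm X).

Definition opmon : monData k :=
  @MonData k (opcat A) (fun X Y => X ⊗ Y) (fun X X' Y Y' f g => f ⊠ g) 𝟙
    (fun X Y Z => ai X Y Z) (fun X => li X) (fun X => ri X).

Lemma monoidal_rev : monoidal revmon.
Proof.
split=> /=.
- by move=> X Y; apply: (mo_id hM).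
- by move=> X X' X'' Y Y' Y'' f' f g' g; apply: (mo_cmp hM).
- move=> X X' Y Y' Z Z' f g h; symmetry.
  apply: (inverse_conj hL (aiP Z Y X) (aiP Z' Y' X')).
  exact: mo_assoc_nat.
- by move=> X Y f; apply: (mo_runit_nat hM).
- by move=> X Y f; apply: (mo_lunit_nat hM).
- by move=> X Y Z; exists (assocm Z Y X); apply: inverseC.
- by move=> X; exact: (mo_runit_iso hM).
- by move=> X; exact: (mo_lunit_iso hM).
- by move=> W X Y Z; apply: pentagon_inv.
- move=> X Y; change (runitm Y ⊠ \1_X ∘ ai Y 𝟙 X = \1_Y ⊠ lunitm X :> Mor _ (Y ⊗ X)).
  by rewrite -(mo_triangle hM) -assoc (proj2 (aiP _ _ _)) (lc_idr hL).
Qed.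

Lemma bilinear_rev : tens_bilinear revmon.
Proof. by split=> *; [apply: (proj2 hB) | apply: (proj1 hB)]. Qed.

Lemma monoidal_op : monoidal opmon.
Proof.
split=> /=.
- by move=> X Y; apply: (mo_id hM).
- by move=> X X' X'' Y Y' Y'' f' f g' g; apply: (mo_cmp hM).
- move=> X X' Y Y' Z Z' f g h.
  apply: (inverse_conj hL (aiP X' Y' Z') (aiP X Y Z)).
  exact: mo_assoc_nat.
- move=> X Y f; apply: (inverse_conj hL (liP Y) (liP X)).
  exact: mo_lunit_nat.
- move=> X Y f; apply: (inverse_conj hL (riP Y) (riP X)).
  exact: mo_runit_nat.
- by move=> X Y Z; exists (assocm X Y Z); case: (aiP X Y Z).
- by move=> X; exists (lunitm X); case: (liP X).
- by move=> X; exists (runitm X); case: (riP X).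
- by move=> W X Y Z; apply: (etrans (pentagon_inv W X Y Z)); rewrite /= assoc.
- move=> X Y; change (ai X 𝟙 Y ∘ \1_X ⊠ li Y = ri X ⊠ \1_Y).
  have i1 := inverse_cmp hL (inverse_tens hM (inverse_id hL X) (liP Y))
    (aiP X 𝟙 Y).
  rewrite (mo_triangle hM) in i1.
  exact: (inverse_uniq hL i1 (inverse_tens hM (riP X) (inverse_id hL Y))).
Qed.

Lemma bilinear_op : tens_bilinear opmon.
Proof. by split=> *; [apply: (proj1 hB) | apply: (proj2 hB)]. Qed.

Lemma dual_pair_rev D X ev coev : @dual_pair k A D X ev coev ->
  @dual_pair k revmon X D ev coev.
Proof.
case=> h1 [b hb h2]; split=> /=.
  by rewrite -h2 (inverse_uniq hL hb (aiP D X D)).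
exists (assocm X D X); last exact: h1.
exact: inverseC (aiP X D X).
Qed.

Lemma zigzag_op D X ev coev : @dual_pair k A X D ev coev ->
  @runitm k opmon X ∘ @tensm k opmon _ _ _ _ \1_X coev
    ∘ @assocm k opmon X D X ∘ @tensm k opmon _ _ _ _ ev \1_X
  = @lunitm k opmon X.
Proof.
case=> _ [b hb] /=; rewrite (inverse_uniq hL hb (aiP _ _ _)) => e.
change (ev ⊠ \1_X ∘ (ai X D X ∘ (\1_X ⊠ coev ∘ ri X)) = li X).
transitivity (li X ∘ (lunitm X ∘ ev ⊠ \1_X ∘ ai X D X ∘ \1_X ⊠ coev) ∘ ri X).
  by rewrite !assoc (proj1 (liP X)) (lc_idl hL).
by rewrite e -assoc (proj2 (riP X)) (lc_idr hL).
Qed.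

End Reversal.

Section Biexact.
Variables (k : fieldType) (A : monData k) (hA : multitensor A).
Implicit Types X Y Z M N : A.
Let hL := ab_linear (mt_abelian hA).
Let hM := mt_monoidal hA.
Let hB := mt_bilinear hA.

Lemma tens_exact_l X Y' Y Q (i : Mor Y' Y) (p : Mor Y Q) :
  short_exact i p -> short_exact (i ⊠ \1_X) (p ⊠ \1_X).
Proof.
case=> ki cp; have [[D [ev [coev [z _]]]] [E [ev' [coev' d']]]] := mt_rigid hA X.
split; last exact: (tens_cokernel hL hM hB z).
exact: (@tens_cokernel k (opmon hM) (linear_op hL) (monoidal_op hL hM)
  (bilinear_op hM hB) _ _ _ _ (zigzag_op hL hM d') Y Q Y' p i ki).
Qed.

Lemma tens_exact_r X Y' Y Q (i : Mor Y' Y) (p : Mor Y Q) :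
  short_exact i p -> short_exact (\1_X ⊠ i) (\1_X ⊠ p).
Proof.
case=> ki cp; have [[D [ev [coev d]]] [E [ev' [coev' d']]]] := mt_rigid hA X.
have hMr := monoidal_rev hL hM; have hBr := bilinear_rev hM hB.
have [z _] := dual_pair_rev hL hM d'; have dr := dual_pair_rev hL hM d.
split; last exact: (@tens_cokernel k (revmon hM) hL hMr hBr _ _ _ _ z).
exact: (@tens_cokernel k (opmon hMr) (linear_op hL)
  (@monoidal_op k (revmon hM) hL hMr)
  (bilinear_op hMr hBr) _ _ _ _ 
  (@zigzag_op k (revmon hM) hL hMr _ _ _ _ dr) Y Q Y' p i ki).
Qed.

Variables (C : A -> Prop) (hC : serre_tensor_ideal C).

Lemma sub_mod_tens M' M X' X (i : Mor M' M) (j : Mor X' X) :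
  sub_mod C i -> sub_mod C j -> sub_mod C (i ⊠ j).
Proof.
move=> [Q [p [sp CQ]]] [R [q [sq CR]]].
have -> : i ⊠ j = i ⊠ \1_X ∘ \1_M' ⊠ j.
  by rewrite -(mo_cmp hM) (lc_idl hL) (lc_idr hL).
apply: (sub_mod_cmp (mt_abelian hA) (proj1 hC)).
  exists (Q ⊗ X), (p ⊠ \1_X); split; first exact: tens_exact_l.
  exact: (proj2 (proj2 hC X Q CQ)).
exists (M' ⊗ R), (\1_M' ⊠ q); split; first exact: tens_exact_r.
exact: (proj1 (proj2 hC M' R CR)).
Qed.

Lemma quo_mod_tens N N' Y Y' (p : Mor N N') (q : Mor Y Y') :
  quo_mod C p -> quo_mod C q -> quo_mod C (p ⊠ q).
Proof.
move=> [Q [i [sp CQ]]] [R [j [sq CR]]].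
have -> : p ⊠ q = p ⊠ \1_Y' ∘ \1_N ⊠ q.
  by rewrite -(mo_cmp hM) (lc_idl hL) (lc_idr hL).
apply: (quo_mod_cmp (mt_abelian hA) (proj1 hC)).
  exists (Q ⊗ Y'), (i ⊠ \1_Y'); split; first exact: tens_exact_l.
  exact: (proj2 (proj2 hC Y' Q CQ)).
exists (N ⊗ R), (\1_N ⊠ j); split; first exact: tens_exact_r.
exact: (proj1 (proj2 hC N R CR)).
Qed.

End Biexact.

Section QuotientMonoidal.
Variables (k : fieldType) (A : monData k) (hA : multitensor A).
Variables (C : A -> Prop) (hC : serre_tensor_ideal C).
Implicit Types M N P X Y Z : A.
Let hab := mt_abelian hA.
Let hS := proj1 hC.
Let hM := mt_monoidal hA.

Definition qindex_tens M N X Y (s : qindex C M N) (t : qindex C X Y) :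
    qindex C (M ⊗ X) (N ⊗ Y) :=
  QIndex (sub_mod_tens hA hC (qincP s) (qincP t))
         (quo_mod_tens hA hC (qprjP s) (qprjP t)).

Definition is_qtens M N X Y (x : qhom hab hS M N) (y : qhom hab hS X Y)
    (z : qhom hab hS (M ⊗ X) (N ⊗ Y)) : Prop :=
  exists (s : qindex C M N) (f : Mor (qsrc s) (qtgt s))
    (t : qindex C X Y) (g : Mor (qsrc t) (qtgt t)),
  [/\ x = qclass hab hS f, y = qclass hab hS g
    & z = qclass hab hS (s := qindex_tens s t) (f ⊠ g)].

Lemma is_qtens_ex M N X Y (x : qhom hab hS M N) (y : qhom hab hS X Y) :
  exists z, is_qtens x y z.
Proof.
have [s [f ->]] := qclassP x; have [t [g ->]] := qclassP y.
by exists (qclass hab hS (s := qindex_tens s t) (f ⊠ g)), s, f, t, g.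
Qed.

Lemma is_qtens_uniq M N X Y (x : qhom hab hS M N) (y : qhom hab hS X Y) z z' :
  is_qtens x y z -> is_qtens x y z' -> z = z'.
Proof.
have restr (s s0 : qindex C M N) f f0 (t t0 : qindex C X Y) g g0 :
    restricts (s := s) f (t := s0) f0 -> restricts (s := t) g (t := t0) g0 ->
    restricts (s := qindex_tens s t) (f ⊠ g) (t := qindex_tens s0 t0) (f0 ⊠ g0).
  case=> u [v [hu hv <-]] [u' [v' [hu' hv' <-]]]; exists (u ⊠ u'), (v ⊠ v').
  by split=> /=; rewrite -!(mo_cmp hM) ?hu ?hu' ?hv ?hv'.
case=> s [f [t [g [-> -> ->]]]] [s' [f' [t' [g' [/qclass_eq ex /qclass_eq ey ->]]]]].
case: ex => s0 [f0 [sf sf']]; case: ey => t0 [g0 [tg tg']].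
apply/qclass_eq; exists (qindex_tens s0 t0), (f0 ⊠ g0).
by split; apply: restr.
Qed.

Definition qtens M N X Y (x : qhom hab hS M N) (y : qhom hab hS X Y) :
    qhom hab hS (M ⊗ X) (N ⊗ Y) :=
  projT1 (cid (is_qtens_ex x y)).

Lemma qtensE M N X Y (s : qindex C M N) f (t : qindex C X Y) g :
  qtens (qclass hab hS (s := s) f) (qclass hab hS (s := t) g)
  = qclass hab hS (s := qindex_tens s t) (f ⊠ g).
Proof.
rewrite /qtens; case: cid => z /= hz; apply: (is_qtens_uniq hz).
by exists s, f, t, g.
Qed.

Definition quomon : monData k :=
  @MonData k (quocat hab hS) (fun X Y => X ⊗ Y) qtens 𝟙
    (fun X Y Z => qT hab hS (assocm X Y Z))
    (fun X => qT hab hS (lunitm X))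
    (fun X => qT hab hS (runitm X)).

End QuotientMonoidal.

(* Main.v *)
Require Import Defs.
From mathcomp Require Import all_boot all_order all_algebra.
From mathcomp Require Import boolp.

Set Implicit Arguments.
Unset Strict Implicit.
Unset Printing Implicit Defensive.

Import GRing.Theory.
Local Open Scope ring_scope.
Local Open Scope cat_scope.

(** The canonical functor T : A -> A/C is the identity on objects and has two
    calculi of fractions. A morphism x of A/C is represented by
    f : M' -> N/N'; pulling N -> N/N' back along f gives s and n in A with T s
    invertible and x ∘ T s = T n, and pushing M' -> M out along f gives a
    denominator on the other side. A morphism killed by T is killed in A by
    composition, on either side, with a morphism which T inverts
    ([quocat_localization]). These properties are abstracted in the predicate
    [localization], which is stable under passing to opposite categories, so
    that each statement about an arbitrary localization functor F : A -> B
    comes with its dual.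

    F preserves kernels and cokernels. Since every morphism of B is, up to an
    isomorphism, of the form F f, the category B has kernels and cokernels, and
    its monomorphisms are kernels because those of A are
    ([localization_abelian]). F sends a simple object to zero or to a simple
    object, so it preserves finite length. Hom spaces of B are left exact in
    both variables, so filtrations of the two objects reduce their finite
    dimensionality to the case of F S and F S' with S and S' simple, where
    Hom(S, S') maps onto Hom(F S, F S') ([loc_full_simple]).

    Associativity of composition in A/C is immediate when the rightmost factor
    is some T a ([qcmp_qT_assoc]); the general case follows as every morphism
    becomes of this form after precomposition with a denominator T s, and T s
    can be cancelled ([qT_cancel]).

    As A is rigid, its tensor product is exact in each variable, so a tensor
    product of image factorizations is again one. Hence the tensor product of A/C
    is functorial ([qtens_cmp]). Constraints, coherence diagrams and dual pairs
    are images under the strict monoidal functor T of those of A. *)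

(** * Finite-dimensional spaces *)

Section LinearAlgebra.
Variable k : fieldType.
Implicit Types U V W : lmodType k.

Definition lcomb V m (c : 'rV[k]_m) (v : 'I_m -> V) := \sum_i c 0 i *: v i.

Definition free_family V m (v : 'I_m -> V) := forall c, lcomb c v = 0 -> c = 0.

(** Bounding the size of free families avoids choosing bases of subspaces and
    quotients of abstract spaces. *)
Definition dim_le n V := forall m (v : 'I_m -> V), free_family v -> (m <= n)%N.

Lemma lcomb_linear V m (v : 'I_m -> V) a c c' :
  lcomb (a *: c + c') v = a *: lcomb c v + lcomb c' v.
Proof.
rewrite /lcomb scaler_sumr -big_split; apply: eq_bigr => i _.
by rewrite !mxE scalerDl scalerA.
Qed.

Lemma map_lcomb U V (f : U -> V) m c (u : 'I_m -> U) :
  (forall a x y, f (a *: x + y) = a *: f x + f y) ->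
  f (lcomb c u) = lcomb c (f \o u).
Proof.
move=> lf; have f0 : f 0 = 0.
  by rewrite -[0](addNr 0) -scaleN1r lf scaleN1r addNr.
have fD x y : f (x + y) = f x + f y by rewrite -[x]scale1r lf !scale1r.
rewrite /lcomb (big_morph f fD f0); apply: eq_bigr => i _.
by rewrite -[_ *: u i]addr0 lf f0 addr0.
Qed.

(** The coefficients of a linear relation between the rows form a vector of the
    left kernel. *)
Lemma free_rV n m (v : 'I_m -> 'rV[k]_n) : free_family v ->
  row_free (\matrix_i v i).
Proof.
move=> fv; rewrite -kermx_eq0; apply/eqP/row_matrixP => i; rewrite row0.
apply: fv; suff -> : lcomb (row i (kermx (\matrix_j v j))) v
  = row i (kermx (\matrix_j v j)) *m \matrix_j v j.
  by rewrite -row_mul mulmx_ker row0.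
by rewrite mulmx_sum_row; apply: eq_bigr => j _; rewrite rowK.
Qed.

Lemma finite_dim_le V : finite_dim V -> exists n, dim_le n V.
Proof.
case=> n [[r lr [r' rK r'K]]]; exists n => m v fv.
have lr' a x y : r (a *: x + y) = a *: r x + r y by apply: lr.
have fr : free_family (r \o v).
  move=> c; rewrite -(map_lcomb c v lr') => e; apply: fv.
  apply: (can_inj rK); rewrite e.
  by rewrite -[0 in RHS](addNr 0) -scaleN1r lr' scaleN1r addNr.
by have /eqP <- := free_rV fr; apply: rank_leq_col.
Qed.

(** A free family of maximal size spans: a vector outside its span would extend
    it to a larger free family. *)
Lemma dim_le_finite n V : dim_le n V -> finite_dim V.
Proof.
move=> hV.
have ex0 : exists m, `[< exists v : 'I_m -> V, free_family v >].
  exists 0%N; apply/asboolP; exists (fun=> 0) => c _.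
  by apply/rowP; case.
have bound m : `[< exists v : 'I_m -> V, free_family v >] -> (m <= n)%N.
  by move=> /asboolP [v /hV].
case: (ex_maxnP ex0 bound) => m /asboolP [v fv] mmax.
have span x : exists c, lcomb c v = x.
  apply/not_existsP => nx.
  pose w (i : 'I_(m + 1)) := if split i is inl j then v j else x.
  suff /mmax : `[< exists v : 'I_(m + 1) -> V, free_family v >].
    by rewrite addn1 ltnn.
  apply/asboolP; exists w => c.
  (* the last coefficient vanishes, as otherwise x would lie in the span *)
  have -> : lcomb c w = lcomb (lsubmx c) v + c 0 (rshift m 0) *: x.
    rewrite /lcomb big_split_ord big_ord1; congr (_ + _ *: _).
      apply: eq_bigr => i _; rewrite !mxE /w.
      by rewrite (unsplitK (inl i : 'I_m + 'I_1)).
    by rewrite /w (unsplitK (inr 0 : 'I_m + 'I_1)).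
  move=> e; have c0 : c 0 (rshift m 0) = 0.
    apply: contrapT => /eqP nz; case: (nx (- (c 0 (rshift m 0))^-1 *: lsubmx c)).
    rewrite -[X in lcomb X]addr0 lcomb_linear /lcomb.
    rewrite [X in _ + X]big1 => [|i _]; last by rewrite mxE scale0r.
    rewrite addr0 -/(lcomb _ v); apply: (scalerI nz); rewrite scalerA mulrN mulfV //.
    by apply/eqP; rewrite scaleN1r eq_sym -addr_eq0 addrC e.
  move: e; rewrite c0 scale0r addr0 => /fv c1.
  rewrite -(hsubmxK c) c1; apply/rowP => i; rewrite !mxE; case: split => j.
    by rewrite mxE.
  by rewrite mxE ord1 c0.
pose g x := projT1 (cid (span x)).
have gK x : lcomb (g x) v = x := projT2 (cid (span x)).
have inj c c' : lcomb c v = lcomb c' v -> c = c'.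
  move=> e; apply/eqP; rewrite -subr_eq0; apply/eqP/fv.
  by rewrite addrC -scaleN1r lcomb_linear e scaleN1r addNr.
exists m; constructor; exists g.
  by move=> a x y; apply: inj; rewrite lcomb_linear !gK.
by exists (fun c => lcomb c v) => // c; apply: inj; rewrite gK.
Qed.

(** Let r be an isomorphism from W to k^b. The relations between the vectors
    r (g (v i)) form a space of dimension at least m - b. A basis of it gives
    free combinations of the v i lying in the kernel of g, and hence in the image
    of f; they lift to a free family of U, which bounds their number. *)
Lemma finite_dim_exact U V W (f : U -> V) (g : V -> W) :
  (forall a x y, f (a *: x + y) = a *: f x + f y) ->
  (forall a x y, g (a *: x + y) = a *: g x + g y) ->
  (forall y, g y = 0 -> exists x, f x = y) ->
  finite_dim U -> finite_dim W -> finite_dim V.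
Proof.
move=> lf lg ex /finite_dim_le [a hU] [b [[r lr br]]].
apply: (@dim_le_finite (a + b)) => m v fv.
have lrg c x y : r (g (c *: x + y)) = c *: r (g x) + r (g y).
  by rewrite lg; apply: lr.
pose G := \matrix_i r (g (v i)).
pose K := row_base (kermx G).
have lift i : exists u, f u = lcomb (row i K) v.
  apply: ex; case: br => r' rK _; apply: (can_inj rK).
  rewrite (map_lcomb _ _ lrg).
  have -> : r 0 = 0 by rewrite -[0](addNr 0) -scaleN1r [r _]lr scaleN1r addNr.
  have -> : lcomb (row i K) (r \o g \o v) = row i K *m G.
    by rewrite mulmx_sum_row; apply: eq_bigr => j _; rewrite rowK.
  apply/sub_kermxP; rewrite -(eq_row_base (kermx G)) /K; exact: row_sub.
pose u i := projT1 (cid (lift i)).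
have hu i : f (u i) = lcomb (row i K) v := projT2 (cid (lift i)).
have fu : free_family u.
  move=> c /(congr1 f); rewrite (map_lcomb _ _ lf).
  have -> : f 0 = 0 by rewrite -[0](addNr 0) -scaleN1r lf scaleN1r addNr.
  have -> : lcomb c (f \o u) = lcomb (c *m K) v.
    rewrite mulmx_sum_row /lcomb.
    transitivity (\sum_i c 0 i *: lcomb (row i K) v).
      by apply: eq_bigr => i _; rewrite /= hu.
    rewrite (eq_bigr (fun j => \sum_i (c 0 i * K i j) *: v j)); last first.
      move=> j _; rewrite summxE -scaler_suml; congr (_ *: _).
      by apply: eq_bigr => i _; rewrite !mxE.
    rewrite exchange_big; apply: eq_bigr => i _; rewrite scaler_sumr.
    by apply: eq_bigr => j _; rewrite scalerA mxE.
  move/fv => /eqP cK; apply/eqP; move: cK.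
  by rewrite mulmx_free_eq0 // row_base_free.
have := hU _ _ fu; rewrite mxrank_ker leq_subLR addnC => h.
by apply: leq_trans h _; rewrite leq_add2l rank_leq_col.
Qed.

End LinearAlgebra.

(** * Exact localization functors *)

Section Isomorphisms.
Variables (k : fieldType) (A : catData k) (hL : linear_category A).
Implicit Types X Y Z W : A.
Let assoc := lc_assoc hL.

Lemma iso_cmp X Y Z (g : Mor Y Z) (f : Mor X Y) :
  is_iso g -> is_iso f -> is_iso (g ∘ f).
Proof.
move=> [g' [g1 g2]] [f' [f1 f2]]; exists (f' ∘ g'); split.
  by rewrite assoc -(assoc f') g1 (lc_idr hL).
by rewrite assoc -(assoc g) f2 (lc_idr hL).
Qed.

Lemma iso_epi X Y (f : Mor X Y) : is_iso f -> epi f.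
Proof.
by case=> g [_ fg] W a b e; rewrite -[a](lc_idr hL) -[b](lc_idr hL) -fg !assoc e.
Qed.

Lemma iso_mono X Y (f : Mor X Y) : is_iso f -> mono f.
Proof.
by case=> g [gf _] W a b e; rewrite -[a](lc_idl hL) -[b](lc_idl hL) -gf -!assoc e.
Qed.

Lemma iso_inverse X Y (f : Mor X Y) (g : Mor Y X) : is_inverse f g -> is_iso g.
Proof. by case=> *; exists f; split. Qed.

Lemma kernel_iso_source X X' Y K (f : Mor X Y) (s : Mor X' X) (i : Mor K X') :
  is_iso s -> is_kernel (f ∘ s) i -> is_kernel f (s ∘ i).
Proof.
move=> is_s; have [s' [s's ss']] := is_s => hi.
apply: is_kernelI.
- exact: (mono_cmp hL (iso_mono is_s) (kernel_mono hL hi)).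
- by rewrite assoc (proj1 hi).
- move=> W g fg0; have [h hh] : exists h, i ∘ h = s' ∘ g.
    by apply: (kernel_fact hi); rewrite -assoc (assoc s) ss' (lc_idl hL).
  by exists h; rewrite -assoc hh assoc ss' (lc_idl hL).
Qed.

Lemma kernel_iso_target X Y K (f : Mor X Y) K' (i : Mor K X) (s : Mor K' K) :
  is_iso s -> is_kernel f i -> is_kernel f (i ∘ s).
Proof.
move=> is_s; have [s' [s's ss']] := is_s => hi; apply: is_kernelI.
- exact: (mono_cmp hL (kernel_mono hL hi) (iso_mono is_s)).
- by rewrite assoc (proj1 hi) (cmp0l hL).
- move=> W g /(kernel_fact hi) [h <-]; exists (s' ∘ h).
  by rewrite assoc -(assoc i) ss' (lc_idr hL).
Qed.

(** The identity of Y factors through p, as it too is killed by 0. *)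
Lemma cokernel_zero_iso X Y Q (p : Mor Y Q) : is_cokernel (0 : Mor X Y) p -> is_iso p.
Proof.
move=> hp; have [q qp] : exists q, q ∘ p = \1_Y.
  by apply: (cokernel_fact hp); apply: (cmp0 hL).
exists q; split=> //; apply: (cokernel_epi hL hp).
by rewrite -assoc qp (lc_idl hL) (lc_idr hL).
Qed.

Lemma zero_ob_id X : \1_X = 0 -> zero_ob X.
Proof.
move=> e; split=> Y f; first by rewrite -[f](lc_idl hL) e (cmp0l hL).
by rewrite -[f](lc_idr hL) e (cmp0 hL).
Qed.

Lemma mono_zero_ob X Y (f : Mor X Y) : mono f -> f = 0 -> zero_ob X.
Proof.
by move=> mf e; apply: zero_ob_id; apply: mf; rewrite e !(cmp0l hL).
Qed.

Lemma epi_zero_ob X Y (f : Mor X Y) : epi f -> f = 0 -> zero_ob Y.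
Proof.
by move=> mf e; apply: zero_ob_id; apply: mf; rewrite e !(cmp0 hL).
Qed.

Lemma iso_zero_ob X Y (f : Mor X Y) : is_iso f -> zero_ob X -> zero_ob Y.
Proof.
by move=> hf hX; apply: (epi_zero_ob (iso_epi hf)); apply: (proj2 hX).
Qed.

End Isomorphisms.

Section AbelianIso.
Variables (k : fieldType) (A : catData k) (hA : abelian A).
Implicit Types X Y Z W : A.
Let hL := ab_linear hA.

Lemma mono_epi_iso X Y (f : Mor X Y) : mono f -> epi f -> is_iso f.
Proof.
move=> /(ab_mono hA) [Z [g hg]] ef.
have g0 : g = 0 by apply: ef; rewrite (proj1 hg) (cmp0l hL).
have [h fh] : exists h, f ∘ h = \1_Y.
  by apply: (kernel_fact hg); rewrite g0 (cmp0l hL).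
exists h; split=> //; apply: (kernel_mono hL hg).
by rewrite (lc_assoc hL) fh (lc_idl hL) (lc_idr hL).
Qed.

(** Only the last step X' -> X -> Z of a filtration of X has to be transported
    along s. *)
Lemma finite_length_iso X Y (s : Mor X Y) :
  is_iso s -> finite_length X -> finite_length Y.
Proof.
move=> is_s h; case: h s is_s => {X} [X hX|X X' Z i p fX [ki cp] sZ] s is_s.
  exact: finite_length0 (iso_zero_ob hL is_s hX).
have [t st] := is_s; have is_t := iso_inverse st.
apply: (@finite_lengthS _ _ X Y Z (s ∘ i) (p ∘ t)) => //; split.
  apply: (kernel_iso_source hL is_s).
  by rewrite -(lc_assoc hL) (proj1 st) (lc_idr hL).
apply: (@kernel_iso_source k (opcat A) (linear_op hL) _ _ _ _ (s ∘ i) t p).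
  by exists s; case: st => st1 st2; split.
by rewrite /= (lc_assoc hL) (proj1 st) (lc_idl hL).
Qed.

Lemma simple_mor S X (f : Mor X S) : simple_ob S -> f = 0 \/ epi f.
Proof.
move=> sS; have [I [e [m [ee mm <-]]]] := image_fact hA f.
case: (proj2 sS _ _ mm) => [zI|im]; last by right; apply: (epi_cmp hL) ee; apply: iso_epi.
by left; rewrite (proj2 zI _ m) (cmp0l hL).
Qed.

End AbelianIso.

Section Localization.
Variables (k : fieldType) (A B : catData k) (F : A -> B).
Variable Fm : forall X Y : A, Mor X Y -> Mor (F X) (F Y).

(** F is a localization at the class of morphisms which it inverts. Requiring
    calculi of fractions on both sides makes the notion self-dual. *)
Record localization : Prop := Localization {
  loc_obj : forall Y : B, exists X, F X = Y;
  loc_id : forall X, Fm \1_X = \1_(F X);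
  loc_cmp : forall X Y Z (g : Mor Y Z) (f : Mor X Y), Fm (g ∘ f) = Fm g ∘ Fm f;
  loc_linear : forall X Y (c : k) (f g : Mor X Y), Fm (c *: f + g) = c *: Fm f + Fm g;
  loc_fracl : forall X Y (x : Mor (F X) (F Y)),
    exists V (s : Mor V X) (f : Mor V Y), is_iso (Fm s) /\ x ∘ Fm s = Fm f;
  loc_fracr : forall X Y (x : Mor (F X) (F Y)),
    exists V (t : Mor Y V) (f : Mor X V), is_iso (Fm t) /\ Fm t ∘ x = Fm f;
  loc_zerol : forall X Y (f : Mor X Y), Fm f = 0 ->
    exists V (s : Mor V X), is_iso (Fm s) /\ f ∘ s = 0;
  loc_zeror : forall X Y (f : Mor X Y), Fm f = 0 ->
    exists V (t : Mor Y V), is_iso (Fm t) /\ t ∘ f = 0 }.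

End Localization.

Lemma localization_op (k : fieldType) (A B : catData k) (F : A -> B)
    (Fm : forall X Y, Mor X Y -> Mor (F X) (F Y)) :
  localization Fm ->
  @localization k (opcat A) (opcat B) F (fun X Y (f : @Mor k A Y X) => Fm Y X f).
Proof.
have isoP X Y (f : @Mor k B X Y) : is_iso f -> @is_iso k (opcat B) Y X f.
  by case=> g [h1 h2]; exists g.
case=> ho hi hc hl fl fr zl zr; split=> //=.
- by move=> X Y x; have [V [t [f [h e]]]] := fr Y X x; exists V, t, f; split; [apply: isoP|].
- by move=> X Y x; have [V [t [f [h e]]]] := fl Y X x; exists V, t, f; split; [apply: isoP|].
- by move=> X Y f /zr [V [t [h e]]]; exists V, t; split; [apply: isoP|].
- by move=> X Y f /zl [V [t [h e]]]; exists V, t; split; [apply: isoP|].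
Qed.

Section LocalizationExact.
Variables (k : fieldType) (A B : catData k) (F : A -> B).
Variable Fm : forall X Y : A, Mor X Y -> Mor (F X) (F Y).
Hypotheses (hA : abelian A) (hB : linear_category B) (hF : localization Fm).
Arguments Fm {X Y}.
Let hL := ab_linear hA.
Let assoc := lc_assoc hB.

Lemma loc0 X Y : Fm (0 : Mor X Y) = 0.
Proof. by rewrite -[0](addNr 0) -scaleN1r (loc_linear hF) scaleN1r addNr. Qed.

Lemma locD X Y (f g : Mor X Y) : Fm (f + g) = Fm f + Fm g.
Proof. by rewrite -[f]scale1r (loc_linear hF) !scale1r. Qed.

Lemma loc_iso X Y (f : Mor X Y) : is_iso f -> is_iso (Fm f).
Proof.
by case=> g [h1 h2]; exists (Fm g); split; rewrite -(loc_cmp hF) ?h1 ?h2 (loc_id hF).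
Qed.

Lemma loc_zero_ob X : zero_ob X -> zero_ob (F X).
Proof.
by move=> h; apply: (zero_ob_id hB); rewrite -(loc_id hF) (proj1 h _ \1_X) loc0.
Qed.

(** Write a morphism killed by F m as a fraction g / s. Then m ∘ g is killed by
    some t inverted by F, and so is g since m is a monomorphism. *)
Lemma loc_mono X Y (m : Mor X Y) : mono m -> mono (Fm m).
Proof.
move=> mm; apply: (monoP0 hB) => W; have [W0 <-] := loc_obj hF W => x mx0.
have [V [s [g [is_s e]]]] := loc_fracl hF x.
have [V' [t [is_t gt]]] : exists V' (t : Mor V' V), is_iso (Fm t) /\ m ∘ g ∘ t = 0.
  by apply: (loc_zerol hF); rewrite (loc_cmp hF) -e assoc mx0 (cmp0l hB).
have g0 : g ∘ t = 0 by apply: mm; rewrite (lc_assoc hL) gt (cmp0 hL).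
apply: (iso_epi hB is_s); rewrite (cmp0l hB) e; apply: (iso_epi hB is_t).
by rewrite -(loc_cmp hF) g0 loc0 (cmp0l hB).
Qed.

(** If F f kills the fraction g / s, then f kills g ∘ t for some t inverted by F,
    so g ∘ t factors through i, and the fraction through F i. *)
Lemma loc_kernel X Y K (f : Mor X Y) (i : Mor K X) :
  is_kernel f i -> is_kernel (Fm f) (Fm i).
Proof.
move=> hi; apply: is_kernelI; first exact: loc_mono (kernel_mono hL hi).
  by rewrite -(loc_cmp hF) (proj1 hi) loc0.
move=> W; have [W0 <-] := loc_obj hF W => x fx0.
have [V [s [g [is_s e]]]] := loc_fracl hF x.
have [V' [t [is_t gt]]] : exists V' (t : Mor V' V), is_iso (Fm t) /\ f ∘ g ∘ t = 0.
  by apply: (loc_zerol hF); rewrite (loc_cmp hF) -e assoc fx0 (cmp0l hB).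
have [h hh] : exists h, i ∘ h = g ∘ t.
  by apply: (kernel_fact hi); rewrite (lc_assoc hL).
have is_st := iso_cmp hB is_s is_t; have [r [r1 _]] := is_st.
exists (Fm h ∘ r); apply: (iso_epi hB is_st).
rewrite -assoc -(assoc _ r) r1 (lc_idr hB) -(loc_cmp hF) hh (loc_cmp hF) -e.
by rewrite assoc.
Qed.
End LocalizationExact.

Section LocalizationAbelian.
Variables (k : fieldType) (A B : catData k) (F : A -> B).
Variable Fm : forall X Y : A, Mor X Y -> Mor (F X) (F Y).
Hypotheses (hA : abelian A) (hB : linear_category B) (hF : localization Fm).
Arguments Fm {X Y}.
Let hL := ab_linear hA.
Let assoc := lc_assoc hB.
Let hAo := abelian_op hA.
Let hBo := linear_op hB.
Let hFo := localization_op hF.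

Lemma loc_epi X Y (p : Mor X Y) : epi p -> epi (Fm p).
Proof. exact: (loc_mono hAo hBo hFo). Qed.

Lemma loc_cokernel X Y Q (f : Mor X Y) (p : Mor Y Q) :
  is_cokernel f p -> is_cokernel (Fm f) (Fm p).
Proof. exact: (loc_kernel hAo hBo hFo). Qed.

Lemma loc_short_exact X Y Z (i : Mor X Y) (p : Mor Y Z) :
  short_exact i p -> short_exact (Fm i) (Fm p).
Proof. by case=> h1 h2; split; [apply: loc_kernel | apply: loc_cokernel]. Qed.

(** If x ∘ F s = F f, a kernel of x is F s ∘ F i, where i is a kernel of f. *)
Lemma loc_has_kernel (X Y : B) (x : Mor X Y) :
  exists K (i : Mor K X), is_kernel x i.
Proof.
have [X0 eX] := loc_obj hF X; have [Y0 eY] := loc_obj hF Y.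
case: _ / eX x => x; case: _ / eY x => x.
have [V [s [f [is_s e]]]] := loc_fracl hF x.
have [K [i hi]] := ab_kernel hA f.
exists (F K), (Fm s ∘ Fm i); apply: (kernel_iso_source hB is_s).
by rewrite e; apply: loc_kernel.
Qed.

(** Up to the isomorphism F s a monomorphism is F f for some f = m ∘ e. As F f
    is monic, F kills the kernel of e, so F e is an isomorphism; and F m is a
    kernel because m is one. *)
Lemma loc_mono_kernel (X Y : B) (x : Mor X Y) : mono x ->
  exists Z (y : Mor Y Z), is_kernel y x.
Proof.
have [X0 eX] := loc_obj hF X; have [Y0 eY] := loc_obj hF Y.
case: _ / eX x => x; case: _ / eY x => x mx.
have [V [s [f [is_s e]]]] := loc_fracl hF x.
have mf : mono (Fm f) by rewrite -e; apply: (mono_cmp hB mx (iso_mono hB is_s)).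
have [I [q [m [eq mm mq]]]] := image_fact hA f.
have [K [i [ki cq]]] := epi_short_exact hA eq.
have i0 : Fm i = 0.
  apply: mf; rewrite (cmp0 hB) -(loc_cmp hF) -mq -(lc_assoc hL) (proj1 ki).
  by rewrite (cmp0 hL) (loc0 hF).
have is_q : is_iso (Fm q).
  apply: (@cokernel_zero_iso _ _ hB (F K)); rewrite -i0; exact: loc_cokernel.
have [Z [g hg]] := ab_mono hA mm.
have [s' ss'] := is_s; have is_s' := iso_inverse ss'.
exists (F Z), (Fm g).
have -> : x = Fm m ∘ (Fm q ∘ s').
  by rewrite assoc -(loc_cmp hF) mq -e -assoc (proj2 ss') (lc_idr hB).
apply: (kernel_iso_target hB); first exact: (iso_cmp hB).
exact: (loc_kernel hA hB hF).
Qed.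

End LocalizationAbelian.

Section LocalizationFinite.
Variables (k : fieldType) (A B : catData k) (F : A -> B).
Variable Fm : forall X Y : A, Mor X Y -> Mor (F X) (F Y).
Hypotheses (hA : abelian A) (hB : linear_category B) (hF : localization Fm).
Arguments Fm {X Y}.
Let hL := ab_linear hA.
Let hAo := abelian_op hA.
Let hBo := linear_op hB.
Let hFo := localization_op hF.

Theorem localization_abelian : abelian B.
Proof.
split=> //.
- have [Z hZ] := ab_zero hA; exists (F Z); exact: (loc_zero_ob hB hF).
- move=> X Y; have [X0 <-] := loc_obj hF X; have [Y0 <-] := loc_obj hF Y.
  have [P [i1 [i2 [p1 [p2 [h1 h2 h3 h4 h5]]]]]] := ab_biproduct hA X0 Y0.
  exists (F P), (Fm i1), (Fm i2), (Fm p1), (Fm p2); split;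
    rewrite -!(loc_cmp hF) ?h1 ?h2 ?h3 ?h4 ?(loc_id hF) ?(loc0 hF) //.
  by rewrite -(locD hF) h5 (loc_id hF).
- exact: (loc_has_kernel hA hB hF).
- by move=> X Y f; apply: (loc_has_kernel hAo hBo hFo).
- exact: (loc_mono_kernel hA hB hF).
- by move=> X Y f; apply: (loc_mono_kernel hAo hBo hFo).
Qed.

Let hBab := localization_abelian.

(** A nonzero subobject of F S is represented by a nonzero f : V -> S, which is
    epi by simplicity. *)
Lemma loc_simple S : simple_ob S -> zero_ob (F S) \/ simple_ob (F S).
Proof.
move=> sS; have [|nz] := pselect (zero_ob (F S)); [by left | right].
split=> // Y; have [Y0 <-] := loc_obj hF Y => x mx.
have [V [s [f [is_s e]]]] := loc_fracl hF x.
have [f0|ef] := simple_mor hA f sS.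
  left; apply: (mono_zero_ob hB mx); apply: (iso_epi hB is_s).
  by rewrite e f0 (loc0 hF) (cmp0l hB).
right; apply: (mono_epi_iso hBab mx); apply: (@epi_cmpl _ _ hB _ _ _ x (Fm s)).
by rewrite e; apply: (loc_epi hA hB hF).
Qed.

(** A simple subquotient which F kills drops out of the filtration: the step
    F i is then an isomorphism. *)
Lemma loc_finite_length X : finite_length X -> finite_length (F X).
Proof.
elim=> {X} [X hX|X Y Z i p _ fX sip sZ].
  by apply: finite_length0; apply: (loc_zero_ob hB hF).
have sF := loc_short_exact hA hB hF sip.
case: (loc_simple sZ) => [zZ|]; last exact: finite_lengthS fX sF.
apply: (finite_length_iso hBab (s := Fm i)) fX.
apply: (mono_epi_iso hBab); first exact: (kernel_mono hB (proj1 sF)).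
apply: (epiP0 hB) => W g g0; have [h <-] := cokernel_fact (proj2 sF) g0.
by rewrite (proj1 zZ _ (Fm p)) (cmp0 hB).
Qed.

(** A nonzero fraction f / s between simple objects has s epi. F kills the
    kernel of s, hence so does f, as F S' would vanish otherwise; thus f
    descends to S. *)
Lemma loc_full_simple S S' (x : Mor (F S) (F S')) :
  simple_ob S -> simple_ob S' -> exists f : Mor S S', Fm f = x.
Proof.
move=> sS sS'; have [->|nz] := pselect (x = 0); first by exists 0; apply: loc0.
have [V [s [f [is_s e]]]] := loc_fracl hF x.
have [s0|es] := simple_mor hA s sS.
  case: nz; apply: (iso_epi hB is_s).
  by rewrite s0 (loc0 hF) !(cmp0 hB).
have [K [i [ki ci]]] := epi_short_exact hA es.
have i0 : Fm i = 0.
  apply: (iso_mono hB is_s).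
  by rewrite -(loc_cmp hF) (proj1 ki) (loc0 hF) (cmp0 hB).
have [fi0|efi] := simple_mor hA (f ∘ i) sS'; last first.
  (* f ∘ i epi and F i = 0 force F S' = 0 *)
  case: nz; apply/(proj1 (epi_zero_ob hB (loc_epi hA hB hF efi) _)).
  by rewrite (loc_cmp hF) i0 (cmp0 hB).
have [g gs] := cokernel_fact ci fi0.
by exists g; apply: (iso_epi hB is_s); rewrite e -gs (loc_cmp hF).
Qed.

End LocalizationFinite.

Section FiniteHom.
Variables (k : fieldType) (A : catData k) (hL : linear_category A).
Implicit Types X Y Z W : A.

Lemma finite_dim_subsingleton (V : lmodType k) : (forall x : V, x = 0) -> finite_dim V.
Proof.
move=> V0; apply: (@dim_le_finite _ 0) => -[//|m] v fv.
have /rowP/(_ ord0) : const_mx 1 = 0 :> 'rV[k]_m.+1 by apply: fv; apply: V0.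
by rewrite !mxE => /eqP; rewrite oner_eq0.
Qed.

Lemma finite_dim_hom_from X Y Z (i : Mor X Y) (p : Mor Y Z) W :
  is_cokernel i p -> finite_dim (Mor Z W) -> finite_dim (Mor X W) ->
  finite_dim (Mor Y W).
Proof.
move=> ci; apply: (finite_dim_exact (f := fun g => g ∘ p) (g := fun g => g ∘ i)).
- by move=> a x y; apply: (lc_linl hL).
- by move=> a x y; apply: (lc_linl hL).
- by move=> g /(cokernel_fact ci).
Qed.

Lemma finite_dim_hom_to X Y Z (i : Mor X Y) (p : Mor Y Z) W :
  is_kernel p i -> finite_dim (Mor W X) -> finite_dim (Mor W Z) ->
  finite_dim (Mor W Y).
Proof.
move=> ci; apply: (finite_dim_exact (f := fun g => i ∘ g) (g := fun g => p ∘ g)).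
- by move=> a x y; apply: (lc_linr hL).
- by move=> a x y; apply: (lc_linr hL).
- by move=> g /(kernel_fact ci).
Qed.

End FiniteHom.

Section LocalizationLocallyFinite.
Variables (k : fieldType) (A B : catData k) (F : A -> B).
Variable Fm : forall X Y : A, Mor X Y -> Mor (F X) (F Y).
Hypotheses (hA : abelian A) (hB : linear_category B) (hF : localization Fm).
Arguments Fm {X Y}.

(** Induction on filtrations of both arguments reduces the finiteness of Hom
    spaces to simple objects S and S', for which F is full. *)
Theorem localization_locally_finite : locally_finite A -> locally_finite B.
Proof.
case=> fdA flA; split; last first.
  by move=> X; have [X0 <-] := loc_obj hF X; apply: (loc_finite_length hA hB hF).
move=> X Y; have [X0 <-] := loc_obj hF X; have [Y0 <-] := loc_obj hF Y.
elim: (flA X0) => {X X0} [X zX|X X1 S i p _ fdX sip sS].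
  apply: finite_dim_subsingleton => x; exact: (proj2 (loc_zero_ob hB hF zX)).
apply: (finite_dim_hom_from hB (proj2 (loc_short_exact hA hB hF sip))) fdX.
elim: (flA Y0) => {Y Y0} [Y zY|Y Y1 S' j q _ fdY sjq sS'].
  apply: finite_dim_subsingleton => x; exact: (proj1 (loc_zero_ob hB hF zY)).
apply: (finite_dim_hom_to hB (proj1 (loc_short_exact hA hB hF sjq)) fdY).
apply: (@finite_dim_exact _ (Mor S S') _ (Mor S S') Fm (fun=> 0)).
- by move=> a x y; apply: (loc_linear hF).
(* with zero as second map, exactness in the middle is surjectivity of F *)
- by move=> a x y; rewrite scaler0 addr0.
- by move=> x _; apply: (loc_full_simple hA hB hF).
- exact: fdA.
- exact: fdA.
Qed.

End LocalizationLocallyFinite.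

(** * The quotient by a Serre subcategory *)

Section SerreFractions.
Variables (k : fieldType) (A : catData k) (hA : abelian A).
Variables (C : A -> Prop) (hC : serre C).
Implicit Types X Y Z W M N : A.
Let hL := ab_linear hA.
Let assoc := lc_assoc hL.

(** The image in X ⊕ Y of the pullback given by [epi_pullback] is jointly monic
    over X and Y, so the kernel of its projection to Y embeds in that of p. *)
Lemma quo_mod_pullback X Y Z (p : Mor X Z) (f : Mor Y Z) : quo_mod C p ->
  exists W (w : Mor W Y) (n : Mor W X), quo_mod C w /\ p ∘ n = f ∘ w.
Proof.
move=> qp; have ep := quo_mod_epi hA qp.
have [V [v [l [ev pl]]]] := epi_pullback hA f ep.
have [P [i1 [i2 [p1 [p2 [h11 h22 h12 h21 h]]]]]] := ab_biproduct hA X Y.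
have [W [e [m [ee mm me]]]] := image_fact hA (i1 ∘ l + i2 ∘ v).
have p1m : p1 ∘ m ∘ e = l.
  rewrite -assoc me (cmpDr hL) !assoc h11 h12 (lc_idl hL) (cmp0l hL).
  exact: addr0.
have p2m : p2 ∘ m ∘ e = v.
  rewrite -assoc me (cmpDr hL) !assoc h21 h22 (lc_idl hL) (cmp0l hL).
  exact: add0r.
have comm : p ∘ (p1 ∘ m) = f ∘ (p2 ∘ m).
  by apply: ee; rewrite -!assoc (assoc p1) (assoc p2) p1m p2m.
exists W, (p2 ∘ m), (p1 ∘ m); split=> //.
have ew : epi (p2 ∘ m) by apply: (@epi_cmpl _ _ hL _ _ _ _ e); rewrite p2m.
have [K [j [kj cj]]] := epi_short_exact hA ew.
exists K, j; split=> //.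
case: qp => K' [j' [[kj' cj'] CK']].
have [t jt] : exists t, j' ∘ t = p1 ∘ m ∘ j.
  by apply: (kernel_fact kj'); rewrite assoc comm -assoc (proj1 kj) (cmp0 hL).
apply: (serre_sub hC (i := t)) CK'; apply: (monoP0 hL) => U g tg0.
apply: (kernel_mono hL kj); rewrite (cmp0 hL); apply: mm; rewrite (cmp0 hL).
rewrite -[m ∘ (j ∘ g)](lc_idl hL) -h (cmpDl hL) -!assoc.
rewrite (assoc m) (assoc p1) (assoc p1) -jt -(assoc j') tg0 !(cmp0 hL).
by rewrite (assoc p2) (assoc p2) (proj1 kj) (cmp0l hL) (cmp0 hL) addr0.
Qed.

(** The image of f ∘ i embeds in the kernel of p, so it lies in C. Hence M' / W
    lies in C, where W is the kernel of f ∘ i. *)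
Lemma sub_mod_vanish M N M' N' (i : Mor M' M) (f : Mor M N) (p : Mor N N') :
  sub_mod C i -> quo_mod C p -> p ∘ f ∘ i = 0 ->
  exists W (j : Mor W M), sub_mod C j /\ f ∘ j = 0.
Proof.
move=> si [K [j [[kj cj] CK]]] e.
have [I [q [m [eq mm mq]]]] := image_fact hA (f ∘ i).
have [t jt] : exists t, j ∘ t = m.
  by apply: (kernel_fact kj); apply: eq; rewrite -assoc mq assoc e (cmp0l hL).
have CI : C I.
  by apply: (serre_sub hC (i := t)) CK; apply: (@mono_cmpr _ _ hL _ _ _ j); rewrite jt.
have [W [l sl]] := epi_short_exact hA eq.
exists W, (i ∘ l); split; first by apply: (sub_mod_cmp hA hC si); exists I, q.
by rewrite assoc -mq -assoc (proj1 (proj1 sl)) (cmp0 hL).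
Qed.

Lemma sub_quo_op X Y (p : Mor X Y) : sub_mod C p <-> @quo_mod _ (opcat A) C Y X p.
Proof. by split; case=> Q [i [[h1 h2] hQ]]; exists Q, i; split. Qed.

End SerreFractions.

Section SerreFractionsDual.
Variables (k : fieldType) (A : catData k) (hA : abelian A).
Variables (C : A -> Prop) (hC : serre C).
Implicit Types X Y Z W M N : A.
Let hO := abelian_op hA.
Let hCO := serre_op hC.

Lemma sub_mod_pushout X Y Z (e : Mor Z X) (f : Mor Z Y) : sub_mod C e ->
  exists W (v : Mor Y W) (b : Mor X W), sub_mod C v /\ b ∘ e = v ∘ f.
Proof.
move=> /sub_quo_op he.
have [W [v [b [hv E]]]] := @quo_mod_pullback _ _ hO _ hCO X Y Z e f he.
by exists W, v, b; split=> //; apply/sub_quo_op.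
Qed.

Lemma quo_mod_vanish M N M' N' (i : Mor M' M) (f : Mor M N) (p : Mor N N') :
  sub_mod C i -> quo_mod C p -> p ∘ f ∘ i = 0 ->
  exists W (q : Mor N W), quo_mod C q /\ q ∘ f = 0.
Proof.
move=> /sub_quo_op hi /quo_sub_op hp e.
have [|W [q [hq E]]] := @sub_mod_vanish _ _ hO _ hCO N M N' M' p f i hp hi.
  by rewrite /= (lc_assoc (ab_linear hA)).
by exists W, q; split=> //; apply/quo_sub_op.
Qed.

End SerreFractionsDual.

Section QuotientCategory.
Variables (k : fieldType) (A : catData k) (hA : abelian A).
Variables (C : A -> Prop) (hC : serre C).
Implicit Types L M N P Q V W : A.
Let hL := ab_linear hA.
Let assoc := lc_assoc hL.
Let idl := lc_idl hL.
Let idr := lc_idr hL.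
Local Notation hom := (qhom hA hC).
Local Notation cls := (qclass hA hC).
Local Notation T := (qT hA hC).
Local Notation "y ∙ x" := (qcmp y x) (at level 40, left associativity).

Lemma qclass_qT M N (s : qindex C M N) (f : Mor M N) g :
  qprj s ∘ f ∘ qinc s = g -> cls (s := s) g = T f.
Proof.
move=> <-; symmetry; apply: qclass_restricts; exists (qinc s), (qprj s).
by split; rewrite /= ?idl ?idr.
Qed.

(** No image factorization is needed to compose with T a: the image which defines
    the composite is that of the inclusion of the source of s in M, already
    monic. *)
Lemma qcmp_qTr M N (s : qindex C M N) f L (a : Mor L M) W (u : Mor W L)
    (hu : sub_mod C u) (a' : Mor W (qsrc s)) :
  qinc s ∘ a' = a ∘ u ->
  cls f ∙ T a = cls (s := QIndex hu (qprjP s)) (f ∘ a').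
Proof.
move=> e; apply: qcmpE.
exists (qsrc s), \1_(qsrc s), (qinc s), u, a', \1_(qtgt s), f.
split=> //=; last by rewrite !idl idr.
by split; [apply: (epi_id hL) | apply: (sub_mod_mono hA (qincP s)) | rewrite idl idr].
Qed.

Lemma qcmp_qTl M N (s : qindex C M N) f L (a : Mor N L) V (v : Mor L V)
    (hv : quo_mod C v) (b : Mor (qtgt s) V) :
  b ∘ qprj s = v ∘ a ->
  T a ∙ cls f = cls (s := QIndex (qincP s) hv) (b ∘ f).
Proof.
move=> e; apply: qcmpE.
exists (qtgt s), (qprj s), \1_(qtgt s), \1_(qsrc s), f, v, b.
split=> //=.
- by split; [apply: (quo_mod_epi hA (qprjP s)) | apply: (mono_id hL) | rewrite idl idr].
- by rewrite !idr idl.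
Qed.

Lemma qcmp_qT M N P (g : Mor N P) (f : Mor M N) : T g ∙ T f = T (g ∘ f).
Proof.
rewrite (@qcmp_qTr _ _ (qindex_id hA hC N P) g _ f _ \1_M (sub_mod_id hA hC M) f);
  last by rewrite /= idl idr.
by apply: qclass_qT; rewrite /= idl idr.
Qed.

Lemma qcmp_idr M N (x : hom M N) : x ∙ T \1_M = x.
Proof.
have [s [f ->]] := qclassP x.
rewrite (@qcmp_qTr _ _ s f _ \1_M _ _ (qincP s) \1_(qsrc s)) ?idl ?idr //.
by case: s f.
Qed.

Lemma qcmp_idl M N (x : hom M N) : T \1_N ∙ x = x.
Proof.
have [s [f ->]] := qclassP x.
rewrite (@qcmp_qTl _ _ s f _ \1_N _ _ (qprjP s) \1_(qtgt s)) ?idl ?idr //.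
by case: s f.
Qed.

(** Summands with common denominators can be composed through the same
    auxiliary data, which makes composition bilinear. *)
Lemma qcmp_linear_r M N P (y : hom N P) c (x x' : hom M N) :
  y ∙ (c *: x + x') = c *: (y ∙ x) + y ∙ x'.
Proof.
have [s [f [f' [-> ->]]]] := qclass2P x x'; have [t [g ->]] := qclassP y.
have [I [e [m [ee mm me]]]] := image_fact hA (qprj s ∘ qinc t).
have sm := sub_mod_image hA hC (quo_mod_epi hA (qprjP s)) (qincP t) mm me.
have qe := quo_mod_image hA hC (qprjP s) (sub_mod_mono hA (qincP t)) ee me.
have [W1 [u1 [a1 [su1 ma1]]]] := sub_mod_pullback hA hC f sm.
have [W2 [u2 [a2 [su2 ma2]]]] := sub_mod_pullback hA hC f' sm.
have [W [w1 [w2 [su ew]]]] := sub_mod_meet hA hC su1 su2.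
have [V [v [b [qv be]]]] := quo_mod_pushout hA hC g qe.
pose r := QIndex (sub_mod_cmp hA hC (qincP s) su) (quo_mod_cmp hA hC qv (qprjP t)).
have comp f0 (a : Mor W I) : m ∘ a = f0 ∘ (u1 ∘ w1) ->
    cls g ∙ cls (s := s) f0 = cls (s := r) (b ∘ a).
  move=> ma; apply: qcmpE; exists I, e, m, (u1 ∘ w1), a, v, b.
  by split.
have ma1' : m ∘ (a1 ∘ w1) = f ∘ (u1 ∘ w1) by rewrite !assoc ma1.
have ma2' : m ∘ (a2 ∘ w2) = f' ∘ (u1 ∘ w1) by rewrite ew !assoc ma2.
rewrite -qclassZ -qclassD (comp _ _ ma1') (comp _ _ ma2') -qclassZ -qclassD.
rewrite (comp _ (c *: (a1 ∘ w1) + a2 ∘ w2)) ?(lc_linr hL) //.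
by rewrite ma1' ma2' (lc_linl hL).
Qed.

Lemma qcmp_linear_l M N P (x : hom M N) c (y y' : hom N P) :
  (c *: y + y') ∙ x = c *: (y ∙ x) + y' ∙ x.
Proof.
have [t [g [g' [-> ->]]]] := qclass2P y y'; have [s [f ->]] := qclassP x.
have [I [e [m [ee mm me]]]] := image_fact hA (qprj s ∘ qinc t).
have sm := sub_mod_image hA hC (quo_mod_epi hA (qprjP s)) (qincP t) mm me.
have qe := quo_mod_image hA hC (qprjP s) (sub_mod_mono hA (qincP t)) ee me.
have [W [u [a [su ma]]]] := sub_mod_pullback hA hC f sm.
have [V1 [v1 [b1 [qv1 be1]]]] := quo_mod_pushout hA hC g qe.
have [V2 [v2 [b2 [qv2 be2]]]] := quo_mod_pushout hA hC g' qe.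
have [V [w1 [w2 [qv ew]]]] := quo_mod_meet hA hC qv1 qv2.
pose r := QIndex (sub_mod_cmp hA hC (qincP s) su) (quo_mod_cmp hA hC qv (qprjP t)).
have comp g0 (b : Mor I V) : b ∘ e = w1 ∘ v1 ∘ g0 ->
    cls (s := t) g0 ∙ cls f = cls (s := r) (b ∘ a).
  move=> be; apply: qcmpE; exists I, e, m, u, a, (w1 ∘ v1), b.
  by split.
have be1' : w1 ∘ b1 ∘ e = w1 ∘ v1 ∘ g by rewrite -!assoc be1.
have be2' : w2 ∘ b2 ∘ e = w1 ∘ v1 ∘ g' by rewrite ew -!assoc be2.
rewrite -qclassZ -qclassD (comp _ _ be1') (comp _ _ be2') -qclassZ -qclassD.
rewrite (comp _ (c *: (w1 ∘ b1) + w2 ∘ b2)) ?(lc_linl hL) //.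
by rewrite be1' be2' (lc_linr hL).
Qed.

(** Restricting the source of x restricts that of y ∙ x in the same way, with
    the same intermediate image. *)
Lemma qcmp_qT_assoc L M N P (y : hom N P) (x : hom M N) (a : Mor L M) :
  y ∙ (x ∙ T a) = y ∙ x ∙ T a.
Proof.
have [s [f ->]] := qclassP x; have [t [g ->]] := qclassP y.
have [r [h H]] := composite_ex hA hC f g; rewrite (qcmpE hA hC H).
have [W [u [a' [hu e]]]] := sub_mod_pullback hA hC a (qincP r).
rewrite (qcmp_qTr h hu e); case: H => I [q [m [z [a0 [v [b [H1 [H2 H3] H4 ->]]]]]]].
rewrite (@qcmp_qTr _ _ s f _ a _ u hu (z ∘ a')); last by rewrite assoc H2.
apply: qcmpE; exists I, q, m, \1_W, (a0 ∘ a'), v, b; split=> //=.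
  by rewrite !idr !assoc H3.
Qed.

(** The hypothesis says that t pushes subobjects with cokernel in C forward to
    such subobjects. If representatives of z and z' agree after composition
    with t on the subobject W of V, they agree on the image of W in M, which is
    large enough to define the same class. *)
Lemma qT_cancel V M N (t : Mor V M) (z z' : hom M N) :
  (forall W I (u : Mor W V) (e : Mor W I) (m : Mor I M),
    sub_mod C u -> epi e -> mono m -> m ∘ e = t ∘ u -> sub_mod C m) ->
  z ∙ T t = z' ∙ T t -> z = z'.
Proof.
move=> dense; have [s [f [f' [-> ->]]]] := qclass2P z z'.
have [W [u [a [hu e]]]] := sub_mod_pullback hA hC t (qincP s).
rewrite !(qcmp_qTr _ hu e) => /qclass_eq [r [h [[x [y /= [hx hy <-]]] [x' [y' /= [hx' hy']]]]]].
have -> : x' = x by apply: (sub_mod_mono hA hu); rewrite hx hx'.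
have -> : y' = y by apply: (quo_mod_epi hA (qprjP s)); rewrite hy hy'.
move=> E; have [I [q [m [eq mm mq]]]] := image_fact hA (a ∘ x).
have sm : sub_mod C (qinc s ∘ m).
  apply: (dense _ _ (qinc r) q) (qincP r) eq _ _.
    exact: (mono_cmp hL (sub_mod_mono hA (qincP s)) mm).
  by rewrite -assoc mq assoc e -assoc hx.
have {}E : y ∘ f' ∘ m = y ∘ f ∘ m.
  by apply: eq; rewrite -!(assoc _ m) mq; move: E; rewrite !assoc.
pose r' := QIndex sm (qprjP r).
transitivity (cls (s := r') (y ∘ f ∘ m)).
  by apply: qclass_restricts; exists m, y.
by symmetry; apply: qclass_restricts; exists m, y.
Qed.

Lemma qT_cancel_sub_mod M' M N (i : Mor M' M) (z z' : hom M N) :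
  sub_mod C i -> z ∙ T i = z' ∙ T i -> z = z'.
Proof.
move=> si; apply: qT_cancel => W I u e m su ee mm E.
apply: (sub_mod_image hA hC (epi_id hL (X := M)) (sub_mod_cmp hA hC si su) mm (e := e)).
by rewrite E idl.
Qed.

Lemma qT_cancel_epi V M N (w : Mor V M) (z z' : hom M N) :
  epi w -> z ∙ T w = z' ∙ T w -> z = z'.
Proof.
by move=> ew; apply: qT_cancel => W I u e m su ee mm; apply: (sub_mod_image hA hC ew su mm).
Qed.

(** If x is represented by f : M' -> N/N', pulling N -> N/N' back along f
    yields V -> M' and a numerator V -> N. *)
Lemma qfraction_l M N (x : hom M N) :
  exists M' (i : Mor M' M) V (w : Mor V M') (n : Mor V N),
  [/\ sub_mod C i, quo_mod C w & x ∙ T (i ∘ w) = T n].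
Proof.
have [s [f ->]] := qclassP x.
have [V [w [n [qw e]]]] := quo_mod_pullback hA hC f (qprjP s).
exists (qsrc s), (qinc s), V, w, n; split=> //; first exact: qincP.
rewrite (@qcmp_qTr _ _ s f _ (qinc s ∘ w) _ \1_V (sub_mod_id hA hC V) w) ?idr //.
by apply: qclass_qT; rewrite /= idr e.
Qed.

(** Dually, pushing M' -> M out along f yields the denominator N/N' -> V. *)
Lemma qfraction_r M N (x : hom M N) :
  exists N' (p : Mor N N') V (v : Mor N' V) (n : Mor M V),
  [/\ quo_mod C p, sub_mod C v & T (v ∘ p) ∙ x = T n].
Proof.
have [s [f ->]] := qclassP x.
have [V [v [n [sv e]]]] := sub_mod_pushout hA hC f (qincP s).
exists (qtgt s), (qprj s), V, v, n; split=> //; first exact: qprjP.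
rewrite (@qcmp_qTl _ _ s f _ (v ∘ qprj s) _ \1_V (quo_mod_id hA hC V) v) ?idl //.
by apply: qclass_qT; rewrite /= idl e.
Qed.

Lemma quocat_linear : linear_category (quocat hA hC).
Proof.
split=> /=.
- move=> M N P Q z y x; have [M' [i [V [w [n [si qw E]]]]]] := qfraction_l x.
  apply: (qT_cancel_sub_mod si); apply: (qT_cancel_epi (quo_mod_epi hA qw)).
  by rewrite -!qcmp_qT_assoc qcmp_qT -!qcmp_qT_assoc E qcmp_qT_assoc.
- by move=> M N x; apply: qcmp_idl.
- by move=> M N x; apply: qcmp_idr.
- by move=> M N P x c y y'; apply: qcmp_linear_l.
- by move=> M N P y c x x'; apply: qcmp_linear_r.
Qed.

Lemma qT_sub_mod_iso M' M (i : Mor M' M) :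
  sub_mod C i -> @is_iso k (quocat hA hC) M' M (T i).
Proof.
move=> si; pose s := QIndex si (quo_mod_id hA hC M').
exists (cls (s := s) \1_M'); split=> /=.
  rewrite (@qcmp_qTr _ _ s _ _ i _ \1_M' (sub_mod_id hA hC M') \1_M') //.
  by apply: qclass_qT; rewrite /= ?idl ?idr ?idl ?idr.
rewrite (@qcmp_qTl _ _ s _ _ i _ \1_M (quo_mod_id hA hC M) i) ?idl ?idr //.
by apply: qclass_qT; rewrite /= ?idl ?idr ?idl ?idr.
Qed.

Lemma qT_quo_mod_iso M M' (p : Mor M M') :
  quo_mod C p -> @is_iso k (quocat hA hC) M M' (T p).
Proof.
move=> qp; pose s := QIndex (sub_mod_id hA hC M') qp.
exists (cls (s := s) \1_M'); split=> /=.
  rewrite (@qcmp_qTr _ _ s _ _ p _ \1_M (sub_mod_id hA hC M) p) ?idl ?idr //.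
  by apply: qclass_qT; rewrite /= ?idl ?idr ?idl ?idr.
rewrite (@qcmp_qTl _ _ s _ _ p _ \1_M' (quo_mod_id hA hC M') \1_M') //.
by apply: qclass_qT; rewrite /= ?idl ?idr ?idl ?idr.
Qed.

Lemma qT_eq0 M N (f : Mor M N) : T f = 0 ->
  exists s : qindex C M N, qprj s ∘ f ∘ qinc s = 0.
Proof.
move=> /qclass_eq [s [h [[u [v /= [hu hv <-]]] [u' [v' /= [_ _ E]]]]]].
by exists s; rewrite -hu -hv idl idr -E (cmp0 hL) (cmp0l hL).
Qed.

(** The denominators are composites of an inclusion with cokernel in C and a
    projection with kernel in C, both of which T inverts. *)
Theorem quocat_localization : @localization k A (quocat hA hC) id (qT hA hC).
Proof.
have isoS := @iso_cmp k (quocat hA hC) quocat_linear.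
split=> //=.
- by move=> Y; exists Y.
- by move=> X Y Z g f; rewrite -qcmp_qT.
- by move=> X Y c f g; rewrite /qT qclassD qclassZ.
- move=> X Y x; have [M' [i [V [w [n [si qw E]]]]]] := qfraction_l x.
  exists V, (i ∘ w), n; split=> //; rewrite -qcmp_qT.
  by apply: (isoS V M' X (T i) (T w)); [apply: qT_sub_mod_iso | apply: qT_quo_mod_iso].
- move=> X Y x; have [N' [p [V [v [n [qp sv E]]]]]] := qfraction_r x.
  exists V, (v ∘ p), n; split=> //; rewrite -qcmp_qT.
  by apply: (isoS Y N' V (T v) (T p)); [apply: qT_sub_mod_iso | apply: qT_quo_mod_iso].
- move=> X Y f /qT_eq0 [s E].
  have [W [j [sj fj0]]] := sub_mod_vanish hA hC (qincP s) (qprjP s) E.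
  by exists W, j; split=> //; apply: qT_sub_mod_iso.
- move=> X Y f /qT_eq0 [s E].
  have [W [q [qq qf0]]] := quo_mod_vanish hA hC (qincP s) (qprjP s) E.
  by exists W, q; split=> //; apply: qT_quo_mod_iso.
Qed.

End QuotientCategory.

(** * The tensor product of the quotient *)

Section QuotientTensor.
Variables (k : fieldType) (A : monData k) (hA : multitensor A).
Variables (C : A -> Prop) (hC : serre_tensor_ideal C).
Implicit Types M N P X Y Z : A.
Let hab := mt_abelian hA.
Let hS := proj1 hC.
Let hM := mt_monoidal hA.
Let hB := mt_bilinear hA.
Let hL := ab_linear hab.
Let idl := lc_idl hL.
Let idr := lc_idr hL.
Local Notation hom := (qhom hab hS).
Local Notation cls := (qclass hab hS).
Local Notation T := (qT hab hS).
Local Notation tns := (@qtens k A hA C hC _ _ _ _).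
Local Notation "y ∙ x" := (qcmp y x) (at level 40, left associativity).

Lemma tensm_epi X X' Y Y' (p : Mor X X') (q : Mor Y Y') :
  epi p -> epi q -> epi (p ⊠ q).
Proof.
move=> /(epi_short_exact hab) [K [i sp]] /(epi_short_exact hab) [K' [i' sq]].
rewrite -[p](idr) -[q](idl) (mo_cmp hM); apply: (epi_cmp hL).
  exact: (cokernel_epi hL (proj2 (tens_exact_l hA Y' sp))).
exact: (cokernel_epi hL (proj2 (tens_exact_r hA X sq))).
Qed.

Lemma tensm_mono X X' Y Y' (i : Mor X X') (j : Mor Y Y') :
  mono i -> mono j -> mono (i ⊠ j).
Proof.
move=> /(mono_short_exact hab) [Q [p si]] /(mono_short_exact hab) [Q' [p' sj]].
rewrite -[i](idr) -[j](idl) (mo_cmp hM); apply: (mono_cmp hL).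
  exact: (kernel_mono hL (proj1 (tens_exact_l hA Y' si))).
exact: (kernel_mono hL (proj1 (tens_exact_r hA X sj))).
Qed.

Lemma qtens_qT M N X Y (f : Mor M N) (g : Mor X Y) : tns (T f) (T g) = T (f ⊠ g).
Proof.
by rewrite qtensE; apply: qclass_qT; rewrite /= !(mo_id hM) idl idr.
Qed.

(** As the tensor product preserves monomorphisms and epimorphisms, the tensor
    product of the image factorizations which define the two composites defines
    the composite of the tensor products. *)
Lemma qtens_cmp M N P X Y Z (y : hom N P) (x : hom M N) (y' : hom Y Z) (x' : hom X Y) :
  tns (y ∙ x) (y' ∙ x') = tns y y' ∙ tns x x'.
Proof.
have [s [f ->]] := qclassP x; have [t [g ->]] := qclassP y.
have [s' [f' ->]] := qclassP x'; have [t' [g' ->]] := qclassP y'.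
have [r [h H]] := composite_ex hab hS f g; rewrite (qcmpE hab hS H).
have [r' [h' H']] := composite_ex hab hS f' g'; rewrite (qcmpE hab hS H').
rewrite !qtensE; symmetry; apply: qcmpE.
case: H => I [e [m [u [a [v [b [[ee mm me] [iu ma] [vp be] ->]]]]]]].
case: H' => I' [e' [m' [u' [a' [v' [b' [[ee' mm' me'] [iu' ma'] [vp' be'] ->]]]]]]].
exists (I ⊗ I'), (e ⊠ e'), (m ⊠ m'), (u ⊠ u'), (a ⊠ a'), (v ⊠ v'), (b ⊠ b').
split=> /=; rewrite -!(mo_cmp hM) ?me ?me' ?iu ?iu' ?ma ?ma' ?vp ?vp' ?be ?be' //.
by split=> //; [apply: tensm_epi | apply: tensm_mono].
Qed.

Lemma quomon_bilinear : tens_bilinear (quomon hA hC).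
Proof.
split=> /= X X' Y Y' c.
  move=> x x' y; have [s [f [f' [-> ->]]]] := qclass2P x x'.
  have [t [g ->]] := qclassP y.
  by rewrite -qclassZ -qclassD !qtensE (proj1 hB) qclassD qclassZ.
move=> x y y'; have [s [f ->]] := qclassP x.
have [t [g [g' [-> ->]]]] := qclass2P y y'.
by rewrite -qclassZ -qclassD !qtensE (proj2 hB) qclassD qclassZ.
Qed.

Lemma qT_iso X Y (f : Mor X Y) : is_iso f -> @is_iso k (quomon hA hC) X Y (T f).
Proof. by apply: (loc_iso (quocat_localization hab hS)). Qed.

Lemma quomon_monoidal : monoidal (quomon hA hC).
Proof.
split=> /=.
- by move=> X Y; rewrite qtens_qT (mo_id hM).
- by move=> *; apply: qtens_cmp.
- move=> X X' Y Y' Z Z' x y z.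
  (* a carries the inclusion and the projection of l to those of l', so both
     composites are represented on the source of l and the target of l' *)
  have [s [f ->]] := qclassP x; have [t [g ->]] := qclassP y.
  have [r [h ->]] := qclassP z; rewrite !qtensE.
  pose l := qindex_tens hA hC (qindex_tens hA hC s t) r.
  pose l' := qindex_tens hA hC s (qindex_tens hA hC t r).
  rewrite (@qcmp_qTl _ _ hab _ hS _ _ l _ _ (assocm X' Y' Z') _ _ (qprjP l')
    (assocm _ _ _)); last by rewrite /= (mo_assoc_nat hM).
  rewrite (@qcmp_qTr _ _ hab _ hS _ _ l' _ _ (assocm X Y Z) _ _ (qincP l)
    (assocm _ _ _)); last by rewrite /= (mo_assoc_nat hM).
  by rewrite (mo_assoc_nat hM).
- move=> X Y x; have [s [f ->]] := qclassP x; rewrite qtensE.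
  pose l := qindex_tens hA hC (qindex_id hab hS 𝟙 𝟙) s.
  rewrite (@qcmp_qTl _ _ hab _ hS _ _ l _ _ (lunitm Y) _ _ (qprjP s)
    (lunitm _)); last by rewrite /= (mo_lunit_nat hM).
  rewrite (@qcmp_qTr _ _ hab _ hS _ _ s _ _ (lunitm X) _ _ (qincP l)
    (lunitm _)); last by rewrite /= (mo_lunit_nat hM).
  by rewrite (mo_lunit_nat hM).
- move=> X Y x; have [s [f ->]] := qclassP x; rewrite qtensE.
  pose l := qindex_tens hA hC s (qindex_id hab hS 𝟙 𝟙).
  rewrite (@qcmp_qTl _ _ hab _ hS _ _ l _ _ (runitm Y) _ _ (qprjP s)
    (runitm _)); last by rewrite /= (mo_runit_nat hM).
  rewrite (@qcmp_qTr _ _ hab _ hS _ _ s _ _ (runitm X) _ _ (qincP l)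
    (runitm _)); last by rewrite /= (mo_runit_nat hM).
  by rewrite (mo_runit_nat hM).
- by move=> X Y Z; apply: (qT_iso (mo_assoc_iso hM X Y Z)).
- by move=> X; apply: (qT_iso (mo_lunit_iso hM X)).
- by move=> X; apply: (qT_iso (mo_runit_iso hM X)).
- by move=> W X Y Z; rewrite !qtens_qT !qcmp_qT (mo_pentagon hM).
- by move=> X Y; rewrite !qtens_qT !qcmp_qT (mo_triangle hM).
Qed.

Lemma quomon_dual_pair D X (ev : Mor (D ⊗ X) 𝟙) (coev : Mor 𝟙 (X ⊗ D)) :
  dual_pair ev coev -> @dual_pair k (quomon hA hC) D X (T ev) (T coev).
Proof.
case=> z1 [b [b1 b2] z2]; split=> /=; first by rewrite !qtens_qT !qcmp_qT z1.
exists (T b); first by split; rewrite /= qcmp_qT ?b1 ?b2.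
by rewrite /= !qtens_qT !qcmp_qT z2.
Qed.

Lemma quomon_rigid : rigid (quomon hA hC).
Proof.
move=> X; have [[D [ev [coev d]]] [E [ev' [coev' d']]]] := mt_rigid hA X.
split; first by exists D, (T ev), (T coev); apply: quomon_dual_pair.
by exists E, (T ev'), (T coev'); apply: quomon_dual_pair.
Qed.

End QuotientTensor.

Theorem proposition4p10 (k : closedFieldType) (A : monData k)
    (hA : multitensor A) (C : A -> Prop) (hC : serre_tensor_ideal C) :
  multitensor (quomon hA hC).
Proof.
have hab := mt_abelian hA; have hS := proj1 hC.
have hL := quocat_linear (mt_abelian hA) (proj1 hC).
have hF := quocat_localization (mt_abelian hA) (proj1 hC).
split.
- exact: (localization_abelian (mt_abelian hA) hL hF).
- exact: (localization_locally_finite (mt_abelian hA) hL hF (mt_locally_finite hA)).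
- exact: quomon_monoidal.
- exact: quomon_bilinear.
- exact: quomon_rigid.
Qed.
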